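(* Fix $\lambda\in[0,1)$ and $p\in[0,1]$. For every $N$, the process $\mathbf{V}^N(t)$ of the $N$-station system is positive recurrent and admits a unique steady-state distribution $\pi^N$ on $\overline{\mathcal{V}}^\infty$. Moreover, $\pi^N$ converges in distribution, as $N\to\infty$, to $\delta_{\mathbf{v}^I}$, the probability measure on $\overline{\mathcal{V}}^\infty$ (with the $\|\cdot\|_w$ topology) concentrated on the point $\mathbf{v}^I$, where $\mathbf{v}^I$ is the unique element of $\overline{\mathcal{V}}^\infty$ satisfying $\lambda(\mathbf{v}^I_{i-1}-\mathbf{v}^I_i)-(1-p)(\mathbf{v}^I_i-\mathbf{v}^I_{i+1})-g_i(\mathbf{v}^I)=0$ for all $i\ge1$.
   Context: The $N$-station system: station $n\in\{1,\dots,N\}$ has queue length $Q_n(t)\in\mathbb{Z}_+$, initially finite. Tasks arrive to each station according to independent Poisson processes of rate $\lambda$. Each station has an independent Poisson clock of rate $1-p$: at a tick, if $Q_n>0$ one task leaves station $n$, otherwise nothing happens. An independent central Poisson clock of rate $Np$: at a tick, if $\sum_nQ_n>0$ one task leaves a station chosen uniformly at random among stations with a longest queue, otherwise nothing happens. $\mathbf{S}^N_i(t)=\frac1N\sum_n\mathbb{I}\{Q_n(t)\ge i\}$, $\mathbf{V}^N_i(t)=\sum_{j\ge i}\mathbf{S}^N_j(t)$, $i\ge0$. $\mathcal{S}=\{\mathbf{s}\in[0,1]^{\mathbb{Z}_+}:1=\mathbf{s}_0\ge\mathbf{s}_1\ge\cdots\ge0\}$, $\overline{\mathcal{S}}^\infty=\{\mathbf{s}\in\mathcal{S}:\sum_{i\ge1}\mathbf{s}_i<\infty\}$,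 $\overline{\mathcal{V}}^\infty=\{\mathbf{v}:\mathbf{v}_i=\sum_{j\ge i}\mathbf{s}_j\ \forall i,\text{ for some }\mathbf{s}\in\overline{\mathcal{S}}^\infty\}$, $\|\mathbf{x}\|_w^2=\sum_{i\ge0}2^{-i}\mathbf{x}_i^2$. For $i\ge1$: $g_i(\mathbf{v})=p$ if $\mathbf{v}_i>0$, $=\min\{\lambda\mathbf{v}_{i-1},p\}$ if $\mathbf{v}_i=0<\mathbf{v}_{i-1}$, $=0$ if $\mathbf{v}_i=\mathbf{v}_{i-1}=0$. (Such $\mathbf{v}^I$ exists and is unique.) *)

(* Defs.v *)
From HB Require Import structures.
From mathcomp Require Import all_boot all_order all_algebra.
From mathcomp Require Import all_classical all_reals all_analysis.
Set Implicit Arguments. Unset Strict Implicit. Unset Printing Implicit Defensive.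
Import Order.TTheory GRing.Theory Num.Theory.
Local Open Scope classical_set_scope.
Local Open Scope ring_scope.

Section CTMC.
(* A continuous-time Markov chain on a (countable) state type S, given by
   its finitely many outgoing transitions: tr x = list of (target, rate).
   Several entries with the same target add up. *)
Variables (R : realType) (S : choiceType) (tr : S -> seq (S * R)).

Definition out (x : S) : seq (S * R) := [seq e <- tr x | e.1 != x].
Definition qrate (x : S) : R := \sum_(e <- out x) e.2.
Definition rate (x y : S) : R := \sum_(e <- out x | e.1 == y) e.2.
Definition jumps (x : S) : seq (S * R) := [seq (e.1, e.2 / qrate x) | e <- out x].

(* one step of the jump chain started from the sub-distribution l
   (finite list of (state, mass)), killed upon entering z *)
Definition kstep (z : S) (l : seq (S * R)) : seq (S * R) :=
  flatten [seq [seq (e.1, w.2 * e.2) | e <- jumps w.1 & e.1 != z] | w <- l].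

(* law of the jump chain at step n, started at x, on the event that
   z has not been hit at steps 0..n *)
Definition kdist (z x : S) (n : nat) : seq (S * R) :=
  iter n (kstep z) (if x == z then [::] else [:: (x, 1)]).

Definition hold (y : S) : \bar R :=
  if qrate y == 0 then +oo%E else ((qrate y)^-1)%:E.

(* E_x[ H_z ], H_z = inf {t >= 0 : X_t = z}: sum over jump steps of the
   expected holding time spent before hitting z *)
Definition Ehit (z x : S) : \bar R :=
  (\esum_(n in [set: nat]) \sum_(w <- kdist z x n) (w.2%:E * hold w.1))%E.

(* Positive recurrence of z (Norris' convention): z absorbing, or the
   expected return time E_z[T_z] (T_z = first return after leaving) is finite *)
Definition pos_recurrent (z : S) : Prop :=
  qrate z = 0 \/
  ((qrate z)^-1%:E + \sum_(e <- jumps z) (e.2%:E * Ehit z e.1) < +oo)%E.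

Definition stationary (valid : S -> Prop) (pi : S -> R) : Prop :=
  [/\ forall x, 0 <= pi x,
      forall x, ~ valid x -> pi x = 0,
      (\esum_(x in [set: S]) (pi x)%:E = 1)%E &
      forall y, (pi y * qrate y)%:E = (\esum_(x in [set: S]) (pi x * rate x y)%:E)%E].

Definition dexpect (pi : S -> R) (g : S -> R) : \bar R :=
  (\esum_(x in [set: S]) (pi x * Num.max (g x) 0)%:E
   - \esum_(x in [set: S]) (pi x * Num.max (- g x) 0)%:E)%E.

End CTMC.

Section System.
Variable R : realType.

(* N-station system, configuration q = (Q_1,...,Q_N) as a list of size N. *)
Definition decr (q : seq nat) (n : nat) : seq nat := set_nth 0%N q n (nth 0%N q n).-1.

Definition maxq (q : seq nat) : nat := \max_(x <- q) x.

(* transitions of Q(t): arrivals (rate lambda each station), local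
   services (rate 1-p at nonempty stations), central service (rate N p,
   split uniformly among stations with a longest queue, if any task) *)
Definition trQ (lam p : R) (N : nat) (q : seq nat) : seq (seq nat * R) :=
  let M := [seq n <- iota 0 N | nth 0%N q n == maxq q] in
  [seq (incr_nth q n, lam) | n <- iota 0 N]
  ++ [seq (decr q n, 1 - p) | n <- iota 0 N & (0 < nth 0%N q n)%N]
  ++ (if (0 < maxq q)%N then [seq (decr q n, N%:R * p / (size M)%:R) | n <- M]
      else [::]).

(* The process V^N(t) is in bijection with the sorted configuration
   (the multiset of queue lengths); its transitions are obtained by lumping. *)
Definition validV (N : nat) (s : seq nat) : Prop := size s = N /\ sorted leq s.
Definition trV (lam p : R) (N : nat) (s : seq nat) : seq (seq nat * R) :=
  [seq (sort leq e.1, e.2) | e <- trQ lam p N s].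

Definition Sfrac (N : nat) (s : seq nat) (i : nat) : R :=
  (count (fun x => i <= x)%N s)%:R / N%:R.
(* V_i = sum_{j >= i} S_j  (S_j = 0 for j > max queue) *)
Definition Vmap (N : nat) (s : seq nat) : nat -> R :=
  fun i => \sum_(i <= j < (maxq s).+1) Sfrac N s j.

Definition pos_rec_chain (lam p : R) (N : nat) : Prop :=
  pos_recurrent (trV lam p N) (nseq N 0%N) /\
  forall x, validV N x -> (Ehit (trV lam p N) (nseq N 0%N) x < +oo)%E.

Definition Sbar (s : nat -> R) : Prop :=
  [/\ s 0%N = 1, forall i, 0 <= s i <= 1, forall i, s i.+1 <= s i &
      (\esum_(i in [set i | (1 <= i)%N]) (s i)%:E < +oo)%E].
Definition Vbar (v : nat -> R) : Prop :=
  exists s, Sbar s /\ forall i, (v i)%:E = (\esum_(j in [set j | (i <= j)%N]) (s j)%:E)%E.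

Definition wdist2 (u v : nat -> R) : \bar R :=
  (\esum_(i in [set: nat]) ((2%:R ^- i) * (u i - v i) ^+ 2)%:E)%E.

Definition g_fun (lam p : R) (v : nat -> R) (i : nat) : R :=
  if 0 < v i then p
  else if 0 < v i.-1 then Num.min (lam * v i.-1) p else 0.

Definition bounded_on_Vbar (f : (nat -> R) -> R) : Prop :=
  exists C, forall v, Vbar v -> `|f v| <= C.
Definition wcontinuous_on_Vbar (f : (nat -> R) -> R) : Prop :=
  forall v, Vbar v -> forall e, 0 < e -> exists d, 0 < d /\
    forall u, Vbar u -> (wdist2 u v < (d ^+ 2)%:E)%E -> `|f u - f v| < e.

End System.
Arguments Sfrac {R}.
Arguments Vmap {R}.

(* Main.v *)
Require Import Defs.
From HB Require Import structures.
From mathcomp Require Import all_boot all_order all_algebra.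
From mathcomp Require Import all_classical all_reals all_analysis.
From mathcomp Require Import finmap zify ring lra.
Set Implicit Arguments. Unset Strict Implicit. Unset Printing Implicit Defensive.
Import Order.TTheory GRing.Theory Num.Theory.
Local Open Scope classical_set_scope.
Local Open Scope ring_scope.

(** No fluid limit is used: everything follows from drift inequalities for the
    generator, which has bounded rates.

    Recurrence: for [1 < a < 1 / lam] the function [F = sum_n a ^ Q_n] satisfies
    [gen F <= - delta F + C N]; adding a large multiple of [1 - eta ^ (sum_n Q_n)]
    makes the drift at most [-1] off the empty state, which bounds the hitting times.
    The occupation measure of an excursion is then stationary. Two stationary laws
    have an invariant minimum, and uniqueness follows since the empty state is
    reachable from everywhere.

    Concentration: put [x_i = V_i - v_i] and [y_i = x_i - x_(i+1)]. In the drift of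
    [x_i ^ 2 / 2] the central-service term has the good sign because [g] is monotone,
    and the noise is [O(1/N)]. With weights [rho ^ i], [rho = min(1, (1 - p) / lam)],
    the remaining quadratic form dominates [(1 - p) / 2 * sum_i rho ^ i y_i ^ 2] up to
    a boundary term, small uniformly in [N] by the exponential moment bound from [F].
    Hence [E y_i ^ 2] tends to [0] for each [i], which with the uniform tail bound
    gives [E ||V - v||_w ^ 2 -> 0]. *)

(** * Sums of nonnegative extended reals over arbitrary index types *)

Section ExtendedSums.
Variables (R : realType) (T : choiceType).
Implicit Types (a b : T -> \bar R) (f g : T -> R).

Lemma esumZ_le (c : R) a (A : set T) : 0 <= c -> (forall i, 0 <= a i)%E ->
  (\esum_(i in A) (c%:E * a i) <= c%:E * \esum_(i in A) a i)%E.
Proof.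
move=> c0 a0; apply: ge_ereal_sup => _ [X [finX XA] <-].
rewrite -ge0_mule_fsumr//; apply: lee_wpmul2l; first by rewrite lee_fin.
by apply: ereal_sup_ubound; exists X.
Qed.

Lemma esumZ (c : R) a (A : set T) : 0 <= c -> (forall i, 0 <= a i)%E ->
  (\esum_(i in A) (c%:E * a i) = c%:E * \esum_(i in A) a i)%E.
Proof.
move=> c0 a0; apply/eqP; rewrite eq_le esumZ_le//=.
have [->|cN0] := eqVneq c 0.
  by rewrite mul0e esum1// => i _; rewrite mul0e.
have ci0 : 0 <= c^-1 by rewrite invr_ge0.
have -> : (\esum_(i in A) a i = \esum_(i in A) (c^-1%:E * (c%:E * a i)))%E.
  by apply: eq_esum => i _; rewrite muleA -EFinM mulVf// mul1e.
apply: (@le_trans _ _ (c%:E * (c^-1%:E * \esum_(i in A) (c%:E * a i))))%E.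
  apply: lee_wpmul2l; first by rewrite lee_fin.
  by apply: esumZ_le => // i; rewrite mule_ge0.
by rewrite muleA -EFinM mulfV// mul1e.
Qed.

Lemma esum_exchange (T' : choiceType) (a : T -> T' -> \bar R) :
  (forall i j, 0 <= a i j)%E ->
  (\esum_(i in [set: T]) \esum_(j in [set: T']) a i j =
   \esum_(j in [set: T']) \esum_(i in [set: T]) a i j)%E.
Proof.
move=> a0; rewrite !esum_esum//.
rewrite (reindex_esum (setT `*`` (fun=> setT)) _ (fun x : T' * T => (x.2, x.1)))//.
split=> //.
- by move=> [i j] [k l] _ _ /= [-> ->].
- by move=> [i j] _; exists (j, i).
Qed.

Lemma esum_point (z : T) (c : R) : 0 <= c ->
  (\esum_(x in [set: T]) ((if x == z then c else 0)%:E) = c%:E)%E.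
Proof.
move=> c0; transitivity (\esum_(x in [set z]) c%:E)%E; last by rewrite esum_set1.
rewrite [RHS]esum_mkcond; apply: eq_esum => x _.
by case: eqP => [->|xz]; [rewrite mem_set|rewrite memNset].
Qed.

Lemma esum_point_split (z : T) a : (forall i, 0 <= a i)%E ->
  (\esum_(x in [set: T]) a x = a z + \esum_(x in ~` [set z]) a x)%E.
Proof.
move=> a0; rewrite (esumID [set z])//; congr (_ + _)%E.
  by rewrite setTI esum_set1.
by rewrite setTI.
Qed.

Lemma esum_ge_point (z : T) a : (forall i, 0 <= a i)%E ->
  (a z <= \esum_(x in [set: T]) a x)%E.
Proof. by move=> a0; rewrite (esum_point_split z a0) leeDl// esum_ge0. Qed.

(** Splits off the index [z] and cancels the finite remainder. It supplies the one balance equation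
    that conservation of total flow provides. *)
Lemma esum_eq_point (z : T) a b : (forall i, 0 <= a i)%E -> (forall i, 0 <= b i)%E ->
  (forall x, x != z -> a x = b x) ->
  (\esum_(x in [set: T]) a x = \esum_(x in [set: T]) b x)%E ->
  (\esum_(x in [set: T]) a x < +oo)%E -> a z = b z.
Proof.
move=> a0 b0 ab; rewrite (esum_point_split z a0) (esum_point_split z b0).
have -> : (\esum_(x in ~` [set z]) b x = \esum_(x in ~` [set z]) a x)%E.
  by apply: eq_esum => x /eqP xz; rewrite ab.
set r := esum _ _; have r0 : (0 <= r)%E by rewrite esum_ge0.
move=> e fin; have rfin : r \is a fin_num.
  rewrite ge0_fin_numE//; apply: le_lt_trans fin; exact: leeDr.
by move: e => /(congr1 (fun u => u - r)%E); rewrite !addeK.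
Qed.

(** The differences [g x - f x] are nonnegative and, the sum of [f] being finite, add up to at most
    zero. *)
Lemma esum_le_eq f g : (forall x, 0 <= f x <= g x) ->
  (\esum_(x in [set: T]) (g x)%:E <= \esum_(x in [set: T]) (f x)%:E)%E ->
  (\esum_(x in [set: T]) (f x)%:E < +oo)%E -> f =1 g.
Proof.
move=> fg gf fin x.
have f0 y : 0 <= f y by case/andP: (fg y).
have le y : f y <= g y by case/andP: (fg y).
have d0 y : 0 <= g y - f y by rewrite subr_ge0.
have E : (\esum_(x in [set: T]) (g x)%:E = \esum_(x in [set: T]) (f x)%:E +
   \esum_(x in [set: T]) (g x - f x)%:E)%E.
  rewrite -esumD; first by apply: eq_esum => y _; rewrite -EFinD addrC subrK.
  - by move=> y _; rewrite lee_fin.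
  - by move=> y _; rewrite lee_fin.
have sf : (\esum_(x in [set: T]) (f x)%:E \is a fin_num)%E.
  by rewrite ge0_fin_numE// esum_ge0// => y _; rewrite lee_fin.
move: gf; rewrite E -leeBrDl// subee// => h.
have : ((g x - f x)%:E <= 0)%E.
  apply: le_trans h.
  by apply: (@esum_ge_point x (fun y => (g y - f y)%:E)) => y; rewrite lee_fin.
by rewrite lee_fin subr_le0 => h'; apply/eqP; rewrite eq_le h' le.
Qed.

End ExtendedSums.

Lemma esum_nat_le (R : realType) (a : nat -> R) (c : \bar R) :
  (forall n, 0 <= a n) -> (forall m, (\sum_(0 <= i < m) a i)%:E <= c)%E ->
  (\esum_(n in [set: nat]) (a n)%:E <= c)%E.
Proof.
move=> a0 h; rewrite -nneseries_esumT; last by move=> n; rewrite lee_fin.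
apply: lime_le.
  by apply: is_cvg_nneseries => n _ _; rewrite lee_fin.
by apply: nearW => m; rewrite sumEFin.
Qed.

(** * Expectations as sums over states, and masses of finite lists *)

Section Mean.
Variables (R : realType) (S : choiceType).
Implicit Types (pi f g : S -> R) (l : seq (S * R)).

Definition mean pi f : \bar R := (\esum_(x in [set: S]) (pi x * f x)%:E)%E.

Definition mass l (y : S) : R := \sum_(e <- l | e.1 == y) e.2.

Lemma mass_ge0 l y : (forall e, e \in l -> 0 <= e.2) -> 0 <= mass l y.
Proof.
by move=> l0; rewrite /mass big_seq_cond; apply: sumr_ge0 => e /andP[/l0].
Qed.

Lemma esum_mass l f : (forall e, e \in l -> 0 <= e.2) -> (forall y, 0 <= f y) ->
  (\esum_(y in [set: S]) (mass l y * f y)%:E = (\sum_(e <- l) e.2 * f e.1)%:E)%E.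
Proof.
move=> + f0; elim: l => [|e l IH] l0.
  by rewrite big_nil esum1// => y _; rewrite /mass big_nil mul0r.
have e0 : 0 <= e.2 by apply: l0; rewrite mem_head.
have {}l0 d : d \in l -> 0 <= d.2 by move=> dl; apply: l0; rewrite inE dl orbT.
rewrite big_cons EFinD -(IH l0) -(esum_point e.1 (mulr_ge0 e0 (f0 e.1))) -esumD.
- apply: eq_esum => y _; rewrite /mass big_cons eq_sym -EFinD.
  by case: eqP => [->|_]; rewrite ?add0r// mulrDl.
- by move=> y _; rewrite lee_fin; case: ifP => // _; rewrite mulr_ge0.
- by move=> y _; rewrite lee_fin mulr_ge0// mass_ge0.
Qed.

Variables (pi : S -> R) (pi0 : forall x, 0 <= pi x).

Lemma mean_ge0 f : (forall x, 0 <= f x) -> (0 <= mean pi f)%E.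
Proof. by move=> f0; apply: esum_ge0 => x _; rewrite lee_fin mulr_ge0. Qed.

Lemma meanD f g : (forall x, 0 <= f x) -> (forall x, 0 <= g x) ->
  mean pi (fun x => f x + g x) = (mean pi f + mean pi g)%E.
Proof.
move=> f0 g0; rewrite /mean -esumD.
- by apply: eq_esum => x _; rewrite mulrDr.
- by move=> x _; rewrite lee_fin mulr_ge0.
- by move=> x _; rewrite lee_fin mulr_ge0.
Qed.

Lemma meanZ c f : 0 <= c -> (forall x, 0 <= f x) ->
  mean pi (fun x => c * f x) = (c%:E * mean pi f)%E.
Proof.
move=> c0 f0; rewrite /mean -esumZ//; last by move=> x; rewrite lee_fin mulr_ge0.
by apply: eq_esum => x _; rewrite -EFinM mulrCA.
Qed.

Lemma mean_cst c : 0 <= c -> (\esum_(x in [set: S]) (pi x)%:E = 1)%E ->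
  mean pi (fun=> c) = c%:E.
Proof.
move=> c0 pi1; have := @meanZ c (fun=> 1) c0 (fun=> ler01).
rewrite mulr1 => ->; rewrite -[RHS]mule1 -pi1; congr (_ * _)%E.
by apply: eq_esum => x _; rewrite mulr1.
Qed.

Lemma mean_sum (I : Type) (r : seq I) (f : I -> S -> R) :
  (forall i x, 0 <= f i x) ->
  mean pi (fun x => \sum_(i <- r) f i x) = (\sum_(i <- r) mean pi (f i))%E.
Proof.
move=> f0; elim: r => [|i r IH].
  by rewrite big_nil /mean esum1// => x _; rewrite big_nil mulr0.
rewrite big_cons -IH -meanD//; last by move=> x; apply: sumr_ge0.
by apply: eq_esum => x _; rewrite big_cons.
Qed.

Lemma le_mean (valid : S -> Prop) f g : (forall x, ~ valid x -> pi x = 0) ->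
  (forall x, valid x -> f x <= g x) -> (mean pi f <= mean pi g)%E.
Proof.
move=> piv fg; apply: le_esum => x _; rewrite lee_fin.
have [/fg h|/piv ->] := pselect (valid x); first exact: ler_wpM2l.
by rewrite !mul0r.
Qed.

End Mean.

(** * Generator, flow identities and drift bounds under a stationary law *)

Section Chain.
Variables (R : realType) (S : choiceType) (tr : S -> seq (S * R)).
Variables (valid : S -> Prop) (Lam : R).
Hypothesis tr_ge0 : forall x e, e \in tr x -> 0 <= e.2.
Hypothesis tr_valid : forall x e, valid x -> e \in tr x -> valid e.1.
Hypothesis qrate_le : forall x, valid x -> qrate tr x <= Lam.
Implicit Types (G D b : S -> R).

Definition gen G (x : S) : R := \sum_(e <- tr x) e.2 * (G e.1 - G x).

Lemma out_ge0 x e : e \in out tr x -> 0 <= e.2.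
Proof. by rewrite mem_filter => /andP[_ /tr_ge0]. Qed.

Lemma out_valid x e : valid x -> e \in out tr x -> valid e.1.
Proof. by move=> vx; rewrite mem_filter => /andP[_ /(tr_valid vx)]. Qed.

Lemma qrate_ge0 x : 0 <= qrate tr x.
Proof. by rewrite /qrate big_seq; apply: sumr_ge0 => e /out_ge0. Qed.

Lemma rate_ge0 x y : 0 <= rate tr x y.
Proof. by rewrite -[rate _ _ _]/(mass (out tr x) y); apply: mass_ge0 => e /out_ge0. Qed.

Lemma genE G x : gen G x = \sum_(e <- out tr x) e.2 * G e.1 - qrate tr x * G x.
Proof.
rewrite /gen /qrate mulr_suml -sumrB /out big_filter [RHS]big_mkcond.
apply: eq_bigr => e _; case: eqP => [->|_]; first by rewrite /= subrr mulr0.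
by rewrite mulrBr.
Qed.

Lemma esum_rate x : (\esum_(y in [set: S]) (rate tr x y)%:E = (qrate tr x)%:E)%E.
Proof.
have := @esum_mass R S (out tr x) (fun=> 1) (@out_ge0 x) (fun=> ler01).
rewrite [X in _ = X%:E](_ : _ = qrate tr x); last first.
  by apply: eq_bigr => e _; rewrite mulr1.
by move=> <-; apply: eq_esum => y _; rewrite mulr1.
Qed.

(** Tonelli: the weighted flow of [nu] is counted by source or by target. With [G = 1], total
    outflow equals total inflow. *)
Lemma flow_in_out G (nu : S -> R) : (forall x, 0 <= G x) -> (forall x, 0 <= nu x) ->
  mean nu (fun x => \sum_(e <- out tr x) e.2 * G e.1) =
  (\esum_(y in [set: S]) (G y)%:E * \esum_(x in [set: S]) (nu x * rate tr x y)%:E)%E.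
Proof.
move=> G0 nu0.
transitivity (\esum_(x in [set: S]) \esum_(y in [set: S])
   (nu x * (rate tr x y * G y))%:E)%E.
  apply: eq_esum => x _; rewrite EFinM -esum_mass//; last exact: out_ge0.
  by rewrite -esumZ// => y; rewrite lee_fin mulr_ge0//; exact: rate_ge0.
rewrite esum_exchange; last first.
  by move=> x y; rewrite lee_fin !mulr_ge0//; exact: rate_ge0.
apply: eq_esum => y _; rewrite -esumZ//; last first.
  by move=> x; rewrite lee_fin mulr_ge0//; exact: rate_ge0.
by apply: eq_esum => x _; rewrite -EFinM; congr _%:E; ring.
Qed.

Lemma stationary_balance pi G : stationary tr valid pi -> (forall x, 0 <= G x) ->
  mean pi (fun x => \sum_(e <- out tr x) e.2 * G e.1) =
  mean pi (fun x => qrate tr x * G x).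
Proof.
move=> [pi0 piv pi1 pib] G0; rewrite flow_in_out//.
by apply: eq_esum => y _; rewrite -pib -EFinM; congr _%:E; ring.
Qed.

(* Truncating [G] at level [m] keeps the drift inequality below [m] and makes
   the drift nonpositive above, so no integrability of [G] is needed. *)
Lemma stationary_drift pi G D b : stationary tr valid pi ->
  (forall x, 0 <= G x) -> (forall x, 0 <= D x) -> (forall x, 0 <= b x) ->
  (forall x, valid x -> gen G x + D x <= b x) -> (mean pi D <= mean pi b)%E.
Proof.
move=> st G0 D0 b0 drift; have [pi0 piv pi1 _] := st.
have key (m : R) : 0 <= m ->
    (mean pi (fun x => if (G x < m)%R then D x else 0%R) <= mean pi b)%E.
  move=> m0; pose Gm x := Num.min (G x) m.
  have Gm0 x : 0 <= Gm x by rewrite le_min G0 m0.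
  have qG0 x : 0 <= qrate tr x * Gm x by rewrite mulr_ge0// qrate_ge0.
  (* Bounded rates make this term, common to both sides of the integrated inequality, finite and
     hence cancellable. *)
  have A : (mean pi (fun x => qrate tr x * Gm x) \is a fin_num).
    rewrite ge0_fin_numE; last exact: mean_ge0.
    apply: (@le_lt_trans _ _ (mean pi (fun=> `|Lam * m|))).
      apply: (le_mean pi0 piv) => x vx; apply: le_trans (ler_norm _).
      by apply: ler_pM; rewrite ?qrate_ge0 ?qrate_le// ge_min lexx orbT.
    by rewrite mean_cst// ltry.
  have le : (mean pi (fun x => \sum_(e <- out tr x) e.2 * Gm e.1 +
      (if G x < m then D x else 0))%R <= mean pi (fun x => qrate tr x * Gm x + b x)%R)%E.
    apply: (le_mean pi0 piv) => x vx.
    case: ltP => [Gxm|mGx].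
      have := drift x vx; rewrite genE {2}/Gm (min_l (ltW Gxm)).
      have : \sum_(e <- out tr x) e.2 * Gm e.1 <= \sum_(e <- out tr x) e.2 * G e.1.
        rewrite big_seq [leRHS]big_seq; apply: ler_sum => e /out_ge0 e0.
        by apply: ler_wpM2l => //; rewrite ge_min lexx.
      lra.
    rewrite addr0 {2}/Gm (min_r mGx); apply: ler_wpDr => //.
    rewrite /qrate mulr_suml big_seq [leRHS]big_seq; apply: ler_sum => e /out_ge0 e0.
    by apply: ler_wpM2l => //; rewrite ge_min lexx orbT.
  move: le; rewrite !meanD//; last first.
  - by move=> x; case: ifP.
  - move=> x; rewrite big_seq; apply: sumr_ge0 => e /out_ge0 e0.
    exact: mulr_ge0.
  by rewrite (stationary_balance st Gm0) leeD2lE.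
apply: ge_ereal_sup => _ [X [finX _] <-].
pose r : seq S := enum_fset (fset_set X).
(* This level exceeds [G] on the whole finite set [X], so truncation does not affect the partial sum
   over [X]. *)
pose m := 1 + \sum_(x <- r) G x.
have m0 : 0 <= m by rewrite addr_ge0// sumr_ge0.
apply: le_trans (key m m0); apply: ereal_sup_ubound; exists X => //.
apply: eq_fsbigr => x xX; congr (_ * _)%:E; rewrite ifT// /m.
have xin : x \in r by rewrite -[x \in r]/(x \in fset_set X) in_fset_set.
rewrite (big_rem x)//=; have : 0 <= \sum_(y <- rem x r) G y.
  exact: sumr_ge0.
lra.
Qed.

End Chain.

Lemma esum_nat_recl (R : realType) (a : nat -> \bar R) : (forall n, 0 <= a n)%E ->
  (\esum_(n in [set: nat]) a n = a 0%N + \esum_(n in [set: nat]) a n.+1)%E.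
Proof.
move=> a0; rewrite (esum_point_split 0%N a0); congr (_ + _)%E.
apply: reindex_esum; split.
- by move=> n _.
- by move=> m n _ _ [].
- by move=> [|n] n0; [case: n0|exists n].
Qed.

(** * Excursions: hitting times and existence of a stationary law *)

Section Excursions.
Variables (R : realType) (S : choiceType) (tr : S -> seq (S * R)).
Variables (valid : S -> Prop) (Lam : R).
Hypothesis tr_ge0 : forall x e, e \in tr x -> 0 <= e.2.
Hypothesis tr_valid : forall x e, valid x -> e \in tr x -> valid e.1.
Hypothesis qrate_le : forall x, valid x -> qrate tr x <= Lam.
Variables (z : S) (H : S -> R).
Hypothesis H_ge0 : forall x, 0 <= H x.
Hypothesis H_drift : forall x, valid x -> x != z -> gen tr H x <= -1.
Implicit Type l : seq (S * R).

Let q := qrate tr.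

Lemma sum_kstep l (f : S -> R) :
  \sum_(e <- kstep tr z l) e.2 * f e.1 =
  \sum_(w <- l) w.2 / q w.1 * \sum_(e <- out tr w.1 | e.1 != z) e.2 * f e.1.
Proof.
rewrite /kstep big_flatten big_map; apply: eq_bigr => w _.
rewrite big_map big_filter /jumps big_map mulr_sumr; apply: eq_bigr => e _ /=.
by rewrite /q; ring.
Qed.

Definition sublaw l := forall w, w \in l -> valid w.1 /\ 0 <= w.2.

Lemma kstep_mem l w : sublaw l -> w \in kstep tr z l ->
  [/\ valid w.1, 0 <= w.2 & w.1 != z].
Proof.
move=> ll /flattenP[_ /mapP[u ul ->]] /mapP[e].
rewrite mem_filter => /andP[ez /mapP[d d_out ed]] ->.
rewrite ed /= in ez *; have [vu u0] := ll _ ul; split=> //.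
- exact: (out_valid tr_valid vu d_out).
- by rewrite !mulr_ge0// ?invr_ge0 ?qrate_ge0//; exact: (out_ge0 tr_ge0 d_out).
Qed.

Lemma iter_kstep_sublaw l n : sublaw l -> sublaw (iter n (kstep tr z) l).
Proof.
by move=> ll; elim: n => //= n IH w /(kstep_mem IH)[].
Qed.

(** A state with zero outgoing rate would have nonnegative drift, contrary to [H_drift]. *)
Lemma qrate_gt0 x : valid x -> x != z -> 0 < q x.
Proof.
move=> vx xz; rewrite lt_def qrate_ge0// andbT; apply/negP => /eqP q0.
have := H_drift vx xz; rewrite genE -/q q0 mul0r subr0.
have : 0 <= \sum_(e <- out tr x) e.2 * H e.1.
  by rewrite big_seq; apply: sumr_ge0 => e /(out_ge0 tr_ge0) e0; exact: mulr_ge0.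
lra.
Qed.

Definition holding l : R := \sum_(w <- l) w.2 / q w.1.
Definition potential l : R := \sum_(w <- l) w.2 * H w.1.

Lemma holding_ge0 l : sublaw l -> 0 <= holding l.
Proof.
move=> ll; rewrite /holding big_seq; apply: sumr_ge0 => w /ll[_ w0].
by rewrite mulr_ge0// invr_ge0 qrate_ge0.
Qed.

(** The drift inequality divided by [q] says that one jump lowers the mean of [H] by at least the
    mean holding time. Mass killed on entering [z] is lost, which helps because [H] is
    nonnegative. *)
Lemma potential_kstep l : sublaw l -> (forall w, w \in l -> w.1 != z) ->
  potential (kstep tr z l) + holding l <= potential l.
Proof.
move=> ll lz; rewrite /potential sum_kstep /holding -big_split /=.
rewrite big_seq [leRHS]big_seq; apply: ler_sum => w wl.
have [vw w0] := ll _ wl; have wz := lz _ wl; have qw := qrate_gt0 vw wz.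
rewrite -[X in _ + X <= _]mulr1 -mulrDr -mulrA; apply: ler_wpM2l => //.
rewrite mulrC ler_pdivrMr//.
have := H_drift vw wz; rewrite genE -/q.
have : \sum_(e <- out tr w.1 | e.1 != z) e.2 * H e.1 <=
       \sum_(e <- out tr w.1) e.2 * H e.1.
  rewrite big_mkcond big_seq [leRHS]big_seq; apply: ler_sum => e /(out_ge0 tr_ge0) e0.
  by case: ifP => // _; exact: mulr_ge0.
by rewrite [H w.1 * _]mulrC; lra.
Qed.

Lemma sum_holding_le l m : sublaw l -> (forall w, w \in l -> w.1 != z) ->
  \sum_(0 <= n < m) holding (iter n (kstep tr z) l) <= potential l.
Proof.
move=> ll lz; suff : \sum_(0 <= n < m) holding (iter n (kstep tr z) l) +
    potential (iter m (kstep tr z) l) <= potential l.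
  apply: le_trans; rewrite lerDl /potential big_seq; apply: sumr_ge0 => w.
  by move=> /(iter_kstep_sublaw ll)[_ w0]; exact: mulr_ge0.
elim: m => [|m IH]; first by rewrite big_nil add0r.
rewrite big_nat_recr//= -addrA [holding _ + _]addrC; apply: le_trans IH.
rewrite lerD2l; apply: potential_kstep; first exact: iter_kstep_sublaw.
by case: m => //= m w /(kstep_mem (iter_kstep_sublaw ll))[].
Qed.

(** Foster's criterion: the accumulated holding times never exceed the initial value of [H]. *)
Lemma Ehit_le x : valid x -> (Ehit tr z x <= (H x)%:E)%E.
Proof.
move=> vx; pose l : seq (S * R) := if x == z then [::] else [:: (x, 1)].
have ll : sublaw l by rewrite /l; case: ifP => // _ w; rewrite inE => /eqP ->.
have lz w : w \in l -> w.1 != z.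
  by rewrite /l; case: ifP => // xz; rewrite inE => /eqP -> /=; rewrite xz.
(* The infinite branch of [hold] never occurs: surviving mass sits off [z], where rates are
   positive. *)
have -> : Ehit tr z x =
    (\esum_(n in [set: nat]) (holding (iter n (kstep tr z) l))%:E)%E.
  apply: eq_esum => n _; rewrite /kdist -/l /holding -sumEFin.
  rewrite big_seq [RHS]big_seq; apply: eq_bigr => w wl.
  have [vw _] := iter_kstep_sublaw ll wl.
  have wz : w.1 != z.
    by case: n wl => [/lz //|n /(kstep_mem (iter_kstep_sublaw ll))[]].
  by rewrite /hold -/q (gt_eqF (qrate_gt0 vw wz)) EFinM.
apply: esum_nat_le => [n|m]; first exact/holding_ge0/iter_kstep_sublaw.
rewrite lee_fin; apply: le_trans (sum_holding_le m ll lz) _.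
by rewrite /potential /l; case: ifP => _; rewrite ?big_nil// big_seq1 mul1r.
Qed.

Lemma massE l y : mass l y = \sum_(e <- l) e.2 * (e.1 == y)%:R.
Proof.
rewrite /mass big_mkcond; apply: eq_bigr => e _.
by case: ifP => _; rewrite ?mulr1 ?mulr0.
Qed.

Lemma mass_kstep l y : y != z ->
  mass (kstep tr z l) y = \sum_(w <- l) w.2 * (rate tr w.1 y / q w.1).
Proof.
move=> yz; rewrite massE (sum_kstep l (fun x => (x == y)%:R)).
apply: eq_bigr => w _; rewrite -mulrA; congr (_ * _); rewrite mulrC; congr (_ / _).
rewrite -[rate _ _ _]/(mass (out tr w.1) y) massE [RHS](bigID (fun e => e.1 != z)) /=.
rewrite [X in _ = _ + X]big1 ?addr0// => e /negPn/eqP ->.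
by rewrite eq_sym (negPf yz) mulr0.
Qed.

(* If [z] is not absorbing, the witness is the normalised expected time spent at
   each state during an excursion from [z]. *)
Lemma stationary_exists : valid z -> exists pi, stationary tr valid pi.
Proof.
(* If [z] is absorbing, the point mass at [z] is stationary. *)
move=> vz; have [qz0|qzN0] := eqVneq (q z) 0.
  have r0 y : rate tr z y = 0.
    apply/eqP; rewrite eq_le rate_ge0// andbT -lee_fin -qz0 /q -(esum_rate tr_ge0).
    by apply: (@esum_ge_point R S y (fun y => (rate tr z y)%:E)) => x;
      rewrite lee_fin rate_ge0.
  exists (fun x => if x == z then 1 else 0); split.
  - by move=> x; case: ifP.
  - by move=> x; case: eqP => // ->.
  - by rewrite esum_point.
  - move=> y; rewrite esum1; last first.
      by move=> x _; case: eqP => [->|_]; rewrite ?r0 ?mulr0 ?mul0r.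
    by case: eqP => [->|_]; rewrite -/q ?qz0 ?mulr0 ?mul0r.
have qz : 0 < q z by rewrite lt_def qzN0 qrate_ge0.
have qgt x : valid x -> 0 < q x.
  by move=> vx; have [->//|xz] := eqVneq x z; exact: qrate_gt0.
have q0 x : 0 <= (q x)^-1 by rewrite invr_ge0 qrate_ge0.
(* Unlike [kdist], this starts at [z] without being killed at step 0, so it follows the excursion
   until its return. *)
pose l n := iter n (kstep tr z) [:: (z, 1)].
have sl0 : sublaw [:: (z, 1)] by move=> w; rewrite inE => /eqP ->.
have sl n : sublaw (l n) by exact: iter_kstep_sublaw.
have l_ge0 n e : e \in l n -> 0 <= e.2 by move=> /sl[].
have m0 n y : 0 <= mass (l n) y by apply: mass_ge0; exact: l_ge0.
have mN n y : ~ valid y -> mass (l n) y = 0.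
  move=> vy; rewrite massE big_seq big1// => e /sl[ve _].
  by case: eqP => [ey|]; rewrite ?mulr0// -ey in vy *.
have a0 n y : (0 <= (mass (l n) y / q y)%:E)%E by rewrite lee_fin mulr_ge0.
pose c := (\esum_(n in [set: nat]) (holding (l n))%:E)%E.
(* No drift is assumed at [z], so the holding time there is split off and the potential bound is
   applied after the first jump. *)
have c_fin : (c < +oo)%E.
  rewrite /c esum_nat_recl; last by move=> n; rewrite lee_fin holding_ge0.
  rewrite lte_add_pinfty ?ltry//.
  apply: (@le_lt_trans _ _ (potential (kstep tr z [:: (z, 1)]))%:E); last by rewrite ltry.
  apply: esum_nat_le => [n|m]; first by rewrite holding_ge0.
  rewrite lee_fin; under eq_bigr do rewrite /l iterSr.
  apply: sum_holding_le => w /(kstep_mem sl0)[]// vw w0; by split.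
have c_gt0 : (0 < c)%E.
  apply: (@lt_le_trans _ _ (holding (l 0%N))%:E).
    by rewrite lte_fin /holding big_seq1 /= mul1r invr_gt0.
  by apply: (@esum_ge_point R _ 0%N (fun n => (holding (l n))%:E)) => n; rewrite lee_fin holding_ge0.
pose pi' y := (\esum_(n in [set: nat]) (mass (l n) y / q y)%:E)%E.
have pi'0 y : (0 <= pi' y)%E by apply: esum_ge0.
have pi'sum : (\esum_(y in [set: S]) pi' y = c)%E.
  rewrite esum_exchange//; apply: eq_esum => n _.
  by rewrite (@esum_mass R S (l n) (fun x => (q x)^-1) (@l_ge0 n)).
have pi'fin y : pi' y \is a fin_num.
  rewrite ge0_fin_numE//; apply: le_lt_trans c_fin; rewrite -pi'sum.
  exact: esum_ge_point.
pose nu y := fine (pi' y).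
have nuE y : (nu y)%:E = pi' y by rewrite /nu fineK.
have nu0 y : 0 <= nu y by rewrite -lee_fin nuE.
have nuN y : ~ valid y -> nu y = 0.
  move=> vy; apply: EFin_inj; rewrite nuE /pi' esum1// => n _.
  by rewrite mN// mul0r.
have nu_sum : (\esum_(y in [set: S]) (nu y)%:E = c)%E.
  by rewrite -pi'sum; apply: eq_esum => y _.
have inE' y : (\esum_(x in [set: S]) (nu x * rate tr x y)%:E =
    \esum_(n in [set: nat]) (\sum_(w <- l n) w.2 * (rate tr w.1 y / q w.1))%:E)%E.
  transitivity (\esum_(x in [set: S]) \esum_(n in [set: nat])
     (mass (l n) x * (rate tr x y / q x))%:E)%E.
    apply: eq_esum => x _; rewrite EFinM nuE muleC /pi' -esumZ//; last exact: rate_ge0.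
    by apply: eq_esum => n _; rewrite -EFinM; congr _%:E; ring.
  rewrite esum_exchange; last first.
    by move=> x n; rewrite lee_fin !mulr_ge0// rate_ge0.
  apply: eq_esum => n _; rewrite (@esum_mass R S (l n) (fun x => rate tr x y / q x))//.
    exact: l_ge0.
  by move=> x; rewrite mulr_ge0// rate_ge0.
(* The mass at step 0 sits at [z], so for [y != z] the index may be shifted by one: each visit to
   [y] is an arrival from the previous step. *)
have outE y : y != z -> ((nu y * q y)%:E = \esum_(n in [set: nat]) (mass (l n.+1) y)%:E)%E.
  move=> yz; have [vy|vy] := pselect (valid y); last first.
    by rewrite nuN// mul0r esum1// => n _; rewrite mN.
  rewrite mulrC EFinM nuE /pi' -esumZ//; last exact: ltW (qgt _ vy).
  rewrite esum_nat_recl; last by move=> n; rewrite mule_ge0// lee_fin ltW// qgt.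
  rewrite {1}/mass big_cons big_nil eq_sym (negPf yz) mul0r mule0 add0e.
  by apply: eq_esum => n _; rewrite -EFinM mulrC divfK// gt_eqF// qgt.
have bal y : ((nu y * q y)%:E = \esum_(x in [set: S]) (nu x * rate tr x y)%:E)%E.
  have off x : x != z -> ((nu x * q x)%:E = \esum_(u in [set: S]) (nu u * rate tr u x)%:E)%E.
    by move=> xz; rewrite outE// inE'; apply: eq_esum => n _; rewrite /l /= mass_kstep.
  (* At [z], total outflow equals total inflow and all other states balance; the total is finite
     since rates are bounded and [c] is finite. *)
  have [->|] := eqVneq y z; last exact: off.
  have A0 x : (0 <= (nu x * q x)%:E)%E by rewrite lee_fin mulr_ge0// qrate_ge0.
  have B0 x : (0 <= \esum_(u in [set: S]) (nu u * rate tr u x)%:E)%E.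
    by apply: esum_ge0 => u _; rewrite lee_fin mulr_ge0// rate_ge0.
  apply: (@esum_eq_point R S z (fun x => (nu x * q x)%:E)
    (fun x => \esum_(u in [set: S]) (nu u * rate tr u x)%:E)%E) => //.
    have := flow_in_out tr_ge0 (fun=> ler01) nu0.
    under [X in _ = X -> _]eq_esum do rewrite mul1e.
    move=> <-; apply: eq_esum => x _; congr (_ * _)%:E.
    by apply: eq_bigr => e _; rewrite mulr1.
  apply: (@le_lt_trans _ _ (mean nu (fun=> `|Lam|))).
    apply: (le_mean nu0 nuN) => x vx; apply: le_trans (ler_norm _).
    exact: qrate_le.
  have -> : mean nu (fun=> `|Lam|) = (`|Lam|%:E * c)%E.
    rewrite /mean -nu_sum -esumZ//.
    by apply: eq_esum => x _; rewrite mulrC.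
  by rewrite lte_mul_pinfty.
have cf : c \is a fin_num by rewrite ge0_fin_numE// ltW.
have d0 : 0 < fine c by rewrite fine_gt0// c_gt0.
exists (fun y => (fine c)^-1 * nu y); split.
- by move=> x; rewrite mulr_ge0// invr_ge0 ltW.
- by move=> x vx; rewrite nuN ?mulr0.
- under eq_esum do rewrite EFinM.
  rewrite esumZ ?invr_ge0 ?ltW// nu_sum -[X in (_ * X)%E](fineK cf) -EFinM mulVf//.
  by rewrite gt_eqF.
- move=> y; rewrite -mulrA EFinM -/q bal -esumZ ?invr_ge0 ?ltW//; last first.
    by move=> x; rewrite lee_fin mulr_ge0// rate_ge0.
  by apply: eq_esum => x _; rewrite -EFinM mulrA.
Qed.

End Excursions.

(** * Uniqueness of the stationary law *)

Section Uniqueness.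
Variables (R : realType) (S : choiceType) (tr : S -> seq (S * R)).
Variables (valid : S -> Prop) (Lam : R).
Hypothesis tr_ge0 : forall x e, e \in tr x -> 0 <= e.2.
Hypothesis qrate_le : forall x, valid x -> qrate tr x <= Lam.
Variables (z : S) (height : S -> nat).
Hypothesis descends : forall x, valid x -> x != z ->
  exists2 y, (height y < height x)%N & 0 < rate tr x y.

Let q := qrate tr.

(** Balance at a state without mass forbids any inflow, so a predecessor with positive rate has no
    mass either. Induction on [height] carries this from [z] to every state. *)
Lemma invariant_eq0 (nu : S -> R) : (forall x, 0 <= nu x) ->
  (forall x, ~ valid x -> nu x = 0) ->
  (forall y, (nu y * q y)%:E = \esum_(x in [set: S]) (nu x * rate tr x y)%:E)%E ->
  nu z = 0 -> forall x, nu x = 0.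
Proof.
move=> nu0 nuN bal nuz x; move: {2}(height x).+1 (ltnSn (height x)) => n.
elim: n x => // n IH x hx.
have [->//|xz] := eqVneq x z; have [vx|/nuN//] := pselect (valid x).
have [y hy rxy] := descends vx xz.
have := bal y; rewrite (IH y) ?mul0r; last by rewrite (leq_trans hy).
move=> e; have : ((nu x * rate tr x y)%:E <= 0)%E.
  rewrite [leRHS]e; apply: (@esum_ge_point R S x (fun x => (nu x * rate tr x y)%:E)) => u.
  by rewrite lee_fin mulr_ge0// rate_ge0.
by rewrite lee_fin pmulr_lle0// => h; apply/eqP; rewrite eq_le h nu0.
Qed.

(* The minimum [nu] of two stationary laws satisfies the balance equations with
   [<=]; both sides have the same finite total, so [nu] is itself invariant. *)
Lemma stationary_le (pi pi' : S -> R) : stationary tr valid pi ->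
  stationary tr valid pi' -> pi z <= pi' z -> forall x, pi x <= pi' x.
Proof.
move=> [pi0 piN pi1 pib] [pi'0 pi'N pi'1 pi'b] le_z.
pose nu x := Num.min (pi x) (pi' x).
have nu0 x : 0 <= nu x by rewrite le_min pi0 pi'0.
have nuN x : ~ valid x -> nu x = 0 by move=> vx; rewrite /nu piN// pi'N// minxx.
have r0 x y : 0 <= rate tr x y by exact: rate_ge0.
pose B y := (\esum_(x in [set: S]) (nu x * rate tr x y)%:E)%E.
have B0 y : (0 <= B y)%E by apply: esum_ge0 => x _; rewrite lee_fin mulr_ge0.
have BA y : (B y <= (nu y * q y)%:E)%E.
  rewrite /q /nu; case: (leP (pi y) (pi' y)) => _.
    rewrite pib; apply: le_esum => x _; rewrite lee_fin; apply: ler_wpM2r => //.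
    by rewrite ge_min lexx.
  rewrite pi'b; apply: le_esum => x _; rewrite lee_fin; apply: ler_wpM2r => //.
  by rewrite ge_min lexx orbT.
have Bf y : B y \is a fin_num.
  by rewrite ge0_fin_numE//; apply: le_lt_trans (BA y) _; rewrite ltry.
have tot : (\esum_(y in [set: S]) (nu y * q y)%:E =
    \esum_(y in [set: S]) (fine (B y))%:E)%E.
  have := flow_in_out tr_ge0 (fun=> ler01) nu0.
  under [X in _ = X -> _]eq_esum do rewrite mul1e.
  rewrite [X in _ = X -> _](_ : _ = (\esum_(y in [set: S]) (fine (B y))%:E)%E); last first.
    by apply: eq_esum => y _; rewrite fineK.
  move=> <-; apply: eq_esum => x _; congr (_ * _)%:E.
  by apply: eq_bigr => e _; rewrite mulr1.
have fin : (\esum_(y in [set: S]) (fine (B y))%:E < +oo)%E.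
  rewrite -tot; apply: (@le_lt_trans _ _ (mean pi (fun=> `|Lam|))).
    apply: le_esum => x _; rewrite lee_fin.
    have [vx|vx] := pselect (valid x); last by rewrite nuN// mul0r mulr_ge0.
    apply: ler_pM; rewrite ?qrate_ge0// ?ge_min ?lexx//.
    by apply: le_trans (ler_norm _); exact: qrate_le.
  by rewrite mean_cst// ltry.
have nub y : (nu y * q y)%:E = B y.
  rewrite -(fineK (Bf y)); congr _%:E; apply/esym.
  apply: (@esum_le_eq R S (fun y => fine (B y)) (fun y => nu y * q y)) => //.
    by move=> x; rewrite fine_ge0//= -lee_fin fineK.
  by rewrite tot.
have al0 x : 0 <= pi x - nu x by rewrite subr_ge0 ge_min lexx.
(* [pi - nu] is again invariant and vanishes at [z], where [pi] is the smaller law. *)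
have al : forall x, pi x - nu x = 0.
  apply: invariant_eq0 => //.
  - by move=> x vx; rewrite piN// nuN// subrr.
  - move=> y; have : (\esum_(x in [set: S]) (pi x * rate tr x y)%:E =
       \esum_(x in [set: S]) ((pi x - nu x) * rate tr x y)%:E + B y)%E.
      rewrite -esumD.
      + by apply: eq_esum => x _; rewrite -EFinD -mulrDl subrK.
      + by move=> x _; rewrite lee_fin mulr_ge0.
      + by move=> x _; rewrite lee_fin mulr_ge0.
    move=> /(congr1 (fun u => u - B y)%E); rewrite addeK// -pib -nub => <-.
    by rewrite -EFinB mulrBl.
  - by rewrite /nu min_l// subrr.
by move=> x; move/eqP: (al x); rewrite subr_eq0 => /eqP ->; rewrite ge_min lexx orbT.
Qed.

Lemma stationary_unique (pi pi' : S -> R) : stationary tr valid pi ->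
  stationary tr valid pi' -> pi = pi'.
Proof.
wlog le_z : pi pi' / pi z <= pi' z => [hw st st'|st st'].
  have [h|/ltW h] := leP (pi z) (pi' z); first exact: hw.
  by apply/esym/hw.
apply/funext; apply: esum_le_eq.
- by move=> x; rewrite (stationary_le st st')// andbT; case: st.
- by case: st => _ _ -> _; case: st' => _ _ ->.
- by case: st => _ _ -> _; rewrite ltry.
Qed.

End Uniqueness.

(** * Symmetric sums over the queues and the effect of one jump on them *)

Section Queues.
Variable R : realType.
Implicit Types (q : seq nat) (h : nat -> R).

Definition qsum h q : R := \sum_(m <- q) h m.

Lemma qsum_perm h q q' : perm_eq q q' -> qsum h q = qsum h q'.
Proof. by move=> qq'; apply: perm_big. Qed.

Lemma qsum_ge0 h q : (forall m, 0 <= h m) -> 0 <= qsum h q.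
Proof. by move=> h0; apply: sumr_ge0. Qed.

Lemma qsum_iota h q N : size q = N ->
  \sum_(n <- iota 0 N) h (nth 0%N q n) = qsum h q.
Proof. by move=> <-; rewrite /qsum [RHS](big_nth 0%N) /index_iota subn0. Qed.

Lemma qsum_iota_pos h q N : size q = N ->
  \sum_(n <- iota 0 N | (0 < nth 0 q n)%N) h (nth 0%N q n) = \sum_(m <- q | (0 < m)%N) h m.
Proof. by move=> <-; rewrite [RHS](big_nth 0%N) /index_iota subn0. Qed.

Lemma qsum_incr_nth h q n : (n < size q)%N ->
  qsum h (incr_nth q n) = qsum h q + (h (nth 0 q n).+1 - h (nth 0%N q n)).
Proof.
rewrite /qsum; elim: q n => // m q IH [|n] /= nq; rewrite !big_cons.
  by ring.
by rewrite IH//; ring.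
Qed.

Lemma qsum_decr h q n : (n < size q)%N ->
  qsum h (decr q n) = qsum h q + (h (nth 0 q n).-1 - h (nth 0%N q n)).
Proof.
rewrite /qsum /decr; elim: q n => // m q IH [|n] /= nq; rewrite !big_cons.
  by ring.
by rewrite IH//; ring.
Qed.

Lemma sumn_incr_nth q n : (n < size q)%N -> sumn (incr_nth q n) = (sumn q).+1.
Proof. by elim: q n => // m q IH [|n] //= nq; rewrite IH// addnS. Qed.

Lemma nth_leq_sumn q n : (nth 0 q n <= sumn q)%N.
Proof.
elim: q n => [|m q IH] [|n] //=; first by rewrite leq_addr.
exact: leq_trans (IH n) (leq_addl _ _).
Qed.

Lemma sumn_decr q n : (n < size q)%N -> (0 < nth 0 q n)%N ->
  sumn (decr q n) = (sumn q).-1.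
Proof.
rewrite /decr; elim: q n => // m q IH [|n] /= nq m0; first by case: m m0.
rewrite IH//; suff : (0 < sumn q)%N by case: (sumn q) => // k _; rewrite addnS.
exact: leq_trans m0 (nth_leq_sumn q n).
Qed.

Lemma leq_maxq q m : m \in q -> (m <= maxq q)%N.
Proof. by move=> mq; apply: (@leq_bigmax_seq _ q xpredT id m mq). Qed.

Lemma maxq_mem q : (0 < size q)%N -> maxq q \in q.
Proof.
rewrite /maxq; elim: q => // m q IH _; rewrite big_cons.
case: q IH => [|k q] IH; first by rewrite big_nil maxn0 mem_head.
have {}IH := IH isT; set M := bigop.body _ _ _ in IH *.
by have [h|h] := leqP m M; rewrite inE ?IH ?orbT ?eqxx.
Qed.

Lemma size_incr q n : (n < size q)%N -> size (incr_nth q n) = size q.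
Proof. by move=> nq; rewrite size_incr_nth nq. Qed.

Lemma size_decr q n : (n < size q)%N -> size (decr q n) = size q.
Proof. by move=> nq; rewrite size_set_nth; apply/maxn_idPr. Qed.

End Queues.

(** * Transition rates of the queueing system *)

Section SystemRates.
Variables (R : realType) (lam p : R) (N : nat).
Hypothesis lam_ge0 : 0 <= lam.
Hypothesis p_ge0 : 0 <= p.
Hypothesis p_le1 : p <= 1.
Hypothesis N_gt0 : (0 < N)%N.
Implicit Type q : seq nat.

Definition argmaxq q : seq nat := [seq n <- iota 0 N | nth 0%N q n == maxq q].

Lemma mem_argmaxq q n : n \in argmaxq q -> (n < N)%N /\ nth 0%N q n = maxq q.
Proof. by rewrite mem_filter mem_iota add0n => /andP[/eqP -> /andP[]]. Qed.

Lemma argmaxq_neq0 q : size q = N -> (0 < size (argmaxq q))%N.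
Proof.
move=> sq; have /nthP-/(_ 0%N)[n nq e] := @maxq_mem q (leq_trans N_gt0 (eq_leq (esym sq))).
have : n \in argmaxq q by rewrite mem_filter e eqxx mem_iota add0n -sq.
by case: (argmaxq q).
Qed.

Lemma sum_trQ q (phi : seq nat -> R) :
  \sum_(e <- trQ lam p N q) e.2 * phi e.1 =
  lam * (\sum_(n <- iota 0 N) phi (incr_nth q n)) +
  (1 - p) * (\sum_(n <- iota 0 N | (0 < nth 0 q n)%N) phi (decr q n)) +
  (if (0 < maxq q)%N then
     N%:R * p / (size (argmaxq q))%:R * \sum_(n <- argmaxq q) phi (decr q n)
   else 0).
Proof.
rewrite /trQ -/(argmaxq q) !big_cat /= addrA; congr (_ + _ + _).
- by rewrite big_map mulr_sumr.
- by rewrite big_map big_filter mulr_sumr.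
- by case: ifP => _; rewrite ?big_nil// big_map mulr_sumr.
Qed.

Lemma trQ_ge0 q e : e \in trQ lam p N q -> 0 <= e.2.
Proof.
rewrite /trQ !mem_cat => /or3P[/mapP[n _ ->]|/mapP[n _ ->]|] //=.
  by rewrite subr_ge0.
by case: ifP => // _ /mapP[n _ ->] /=; rewrite !mulr_ge0.
Qed.

Lemma trV_ge0 q e : e \in trV lam p N q -> 0 <= e.2.
Proof. by case/mapP => d /trQ_ge0 + ->. Qed.

Lemma trV_valid q e : validV N q -> e \in trV lam p N q -> validV N e.1.
Proof.
move=> [sq _] /mapP[d dq ->] /=; split; last exact/sort_sorted/leq_total.
rewrite size_sort; move: dq; rewrite /trQ !mem_cat => /or3P[/mapP[n]|/mapP[n]|].
- by rewrite mem_iota => /andP[_ nN] ->; rewrite size_incr// sq.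
- by rewrite mem_filter mem_iota => /and3P[_ _ nN] ->; rewrite size_decr// sq.
case: ifP => // _ /mapP[n]; rewrite mem_filter mem_iota => /and3P[_ _ nN] ->.
by rewrite size_decr// sq.
Qed.

(** Arrivals have total rate [N * lam], local services at most [N * (1 - p)], the central server at
    most [N * p]; discarding self-loops only lowers the sum. *)
Lemma qrate_trV_le q : validV N q -> qrate (trV lam p N) q <= N%:R * (lam + 1).
Proof.
move=> [sq _]; apply: (@le_trans _ _ (\sum_(e <- trQ lam p N q) e.2 * 1)).
  rewrite /qrate /out big_filter /trV big_map big_mkcond big_seq [leRHS]big_seq.
  by apply: ler_sum => e /trQ_ge0 e0; rewrite mulr1; case: ifP.
rewrite (sum_trQ q (fun=> 1)).
have N0 : 0 <= N%:R :> R by [].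
have s1 : \sum_(n <- iota 0 N) (1 : R) = N%:R.
  by rewrite big_const_seq iter_addr_0 count_predT size_iota.
have s2 : \sum_(n <- iota 0 N | (0 < nth 0 q n)%N) (1 : R) <= N%:R.
  by rewrite -s1 big_mkcond; apply: ler_sum => n _; case: ifP.
have s3 : N%:R * p / (size (argmaxq q))%:R * \sum_(n <- argmaxq q) 1 = N%:R * p.
  rewrite big_const_seq iter_addr_0 count_predT divfK// pnatr_eq0 -lt0n.
  exact: argmaxq_neq0.
have h2 : (1 - p) * (\sum_(n <- iota 0 N | (0 < nth 0 q n)%N) 1) <= (1 - p) * N%:R.
  by apply: ler_wpM2l => //; rewrite subr_ge0.
have h3 : 0 <= N%:R * p by apply: mulr_ge0.
rewrite s1; case: ifP => _; rewrite ?s3; nra.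
Qed.

(** A symmetric [G] does not see the sorting in [trV]. The central term averages over the longest
    queues, all of length [maxq q], so the uniform split leaves a single value of [down]. *)
Lemma gen_trV_le (G : seq nat -> R) (up down : nat -> R) q :
  validV N q -> (forall s s', perm_eq s s' -> G s = G s') ->
  (forall n, (n < N)%N -> G (incr_nth q n) - G q <= up (nth 0%N q n)) ->
  (forall n, (n < N)%N -> (0 < nth 0 q n)%N -> G (decr q n) - G q <= down (nth 0%N q n)) ->
  gen (trV lam p N) G q <= lam * qsum up q + (1 - p) * (\sum_(m <- q | (0 < m)%N) down m) +
    (if (0 < maxq q)%N then N%:R * p * down (maxq q) else 0).
Proof.
move=> [sq _] Gsym hup hdown; rewrite /gen /trV big_map /=.
under eq_bigr do rewrite (Gsym _ _ (permEl (perm_sort leq _))).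
rewrite (sum_trQ q (fun s => G s - G q)).
rewrite -(qsum_iota up sq) -(qsum_iota_pos down sq); apply: lerD; first apply: lerD.
- apply: ler_wpM2l => //; rewrite big_seq [leRHS]big_seq.
  by apply: ler_sum => n; rewrite mem_iota => /andP[_]; exact: hup.
- apply: ler_wpM2l; first by rewrite subr_ge0.
  rewrite big_seq_cond [leRHS]big_seq_cond; apply: ler_sum => n.
  by rewrite mem_iota => /andP[/andP[_ nN] n0]; exact: hdown.
case: ifP => // mx0.
set sM := \sum_(n <- _) _; have -> : N%:R * p / (size (argmaxq q))%:R * sM =
    N%:R * p * (sM / (size (argmaxq q))%:R) by ring.
apply: ler_wpM2l; first exact: mulr_ge0.
rewrite ler_pdivrMr ?ltr0n ?argmaxq_neq0// {}/sM.
have -> : down (maxq q) * (size (argmaxq q))%:R = \sum_(n <- argmaxq q) down (maxq q).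
  by rewrite big_const_seq iter_addr_0 count_predT mulr_natr.
rewrite big_seq [leRHS]big_seq; apply: ler_sum => n /mem_argmaxq[nN e].
by rewrite -e; apply: hdown => //; rewrite e.
Qed.

(** A service at a longest queue lowers the total number of tasks. It has positive rate through the
    local clock when [p < 1] and through the central clock when [p = 1]. *)
Lemma trV_descends q : validV N q -> q != nseq N 0%N ->
  exists2 y, (sumn y < sumn q)%N & 0 < rate (trV lam p N) q y.
Proof.
move=> [sq qs] qz.
have mx0 : (0 < maxq q)%N.
  rewrite lt0n; apply: contraNneq qz => mx0; apply/eqP; rewrite -sq.
  by apply/all_pred1P/allP => m /leq_maxq; rewrite mx0 leqn0 => /eqP ->.
have := argmaxq_neq0 sq; case E: (argmaxq q) => [//|n M] _.
have [nN ne] : (n < N)%N /\ nth 0%N q n = maxq q.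
  by apply: mem_argmaxq; rewrite E mem_head.
have n0 : (0 < nth 0 q n)%N by rewrite ne.
have nq : (n < size q)%N by rewrite sq.
have q0 : (0 < sumn q)%N by exact: leq_trans n0 (nth_leq_sumn q n).
have [r r0 rin] : exists2 r, 0 < r & (decr q n, r) \in trQ lam p N q.
  have [p1|p1] := ltP p 1.
    exists (1 - p); first by rewrite subr_gt0.
    rewrite /trQ !mem_cat; apply/orP; right; apply/orP; left.
    by apply/mapP; exists n => //; rewrite mem_filter n0 mem_iota.
  exists (N%:R * p / (size (argmaxq q))%:R).
    rewrite divr_gt0 ?mulr_gt0 ?ltr0n//; first exact: lt_le_trans p1.
    by rewrite E.
  rewrite /trQ !mem_cat -/(argmaxq q) mx0; apply/orP; right; apply/orP; right.
  by apply/mapP; exists n => //; rewrite E mem_head.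
exists (sort leq (decr q n)).
  by rewrite (perm_sumn (permEl (perm_sort leq _))) sumn_decr// prednK.
apply: lt_le_trans r0 _; rewrite /rate.
(* The total has dropped, so the target differs from [q] and the entry survives the filter in
   [out]. *)
have eo : (sort leq (decr q n), r) \in out (trV lam p N) q.
  rewrite mem_filter /=; apply/andP; split; last by apply/mapP; exists (decr q n, r).
  apply/eqP => e; have := sumn_decr nq n0.
  rewrite -(perm_sumn (permEl (perm_sort leq (decr q n)))) e => h.
  by move: q0; rewrite -ltn_predL -h ltnn.
rewrite big_mkcond (big_rem _ eo) /= eqxx lerDl big_seq; apply: sumr_ge0 => e.
move=> /mem_rem; rewrite mem_filter => /andP[_ /trV_ge0 e0].
by case: ifP.
Qed.

End SystemRates.

(** * Lyapunov functions and positive recurrence *)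

Section Lyapunov.
Variables (R : realType) (lam p a : R) (N : nat).
Hypothesis lam_ge0 : 0 <= lam.
Hypothesis lam_lt1 : lam < 1.
Hypothesis p_ge0 : 0 <= p.
Hypothesis p_le1 : p <= 1.
Hypothesis a_gt1 : 1 < a.
Hypothesis lam_a : lam * a < 1.
Hypothesis N_gt0 : (0 < N)%N.
Implicit Type q : seq nat.

Definition expo (m : nat) : R := a ^+ m.

Lemma a_gt0 : 0 < a. Proof. by move: a_gt1; lra. Qed.

Lemma expo_ge0 m : 0 <= expo m. Proof. by rewrite exprn_ge0// ltW// a_gt0. Qed.

(** Equals [(1 - a^-1) - lam * (a - 1)]: the relative decrease of [a ^ m] under a service minus
    [lam] times its relative increase under an arrival. *)
Definition expo_rate : R := (a - 1) * (a^-1 - lam).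

Lemma expo_rate_gt0 : 0 < expo_rate.
Proof.
rewrite mulr_gt0 ?subr_gt0//; move: lam_a; rewrite -ltr_pdivlMr ?a_gt0//.
by rewrite mul1r.
Qed.

(* The station with the longest queue has at least the average of [a ^ Q], so the
   central server is worth at least a local service rate [p] at every station. *)
Lemma gen_expo q : validV N q ->
  gen (trV lam p N) (qsum expo) q + expo_rate * qsum expo q <= (1 - a^-1) * N%:R.
Proof.
move=> vq; have [sq _] := vq; have a0 := a_gt0; have aN0 : a != 0 by rewrite gt_eqF.
have up n : (n < N)%N -> qsum expo (incr_nth q n) - qsum expo q <=
    (a - 1) * expo (nth 0%N q n).
  by move=> nN; rewrite qsum_incr_nth ?sq// /expo exprS; lra.
have down n : (n < N)%N -> (0 < nth 0 q n)%N -> qsum expo (decr q n) - qsum expo q <=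
    - (1 - a^-1) * expo (nth 0%N q n).
  move=> nN; rewrite qsum_decr ?sq// /expo; case: (nth 0%N q n) => // m _ /=.
  by rewrite exprS mulNr mulrBl mul1r mulKf//; lra.
have sym (s s' : seq nat) : perm_eq s s' -> qsum expo s = qsum expo s'.
  exact: qsum_perm.
have := @gen_trV_le R lam p N lam_ge0 p_ge0 p_le1 N_gt0 (qsum expo)
  (fun m => (a - 1) * expo m) (fun m => - (1 - a^-1) * expo m) q vq sym up down.
set F := qsum expo q; set K := 1 - a^-1.
have K0 : 0 <= K by rewrite subr_ge0 invf_le1// ltW.
have -> : qsum (fun m => (a - 1) * expo m) q = (a - 1) * F by rewrite mulr_sumr.
rewrite -mulr_sumr; set X := \sum_(m <- q | _) _.
have NE : N%:R = qsum (fun=> 1) q :> R.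
  by rewrite /qsum big_const_seq iter_addr_0 count_predT sq.
(* Empty stations, absent from [X], contribute [a ^ 0 = 1] each to [F]. *)
have X_ge : F - N%:R <= X.
  rewrite NE /F /qsum -sumrB /X [leRHS]big_mkcond; apply: ler_sum => m _.
  by case: m => [|m] /=; rewrite ?subrr// gerBl.
have cen : (if (0 < maxq q)%N then N%:R * p * (- K * expo (maxq q)) else 0) <=
    - (p * (K * (F - N%:R))).
  case: ifP => [_|/negbT]; last first.
    rewrite -leqNgt leqn0 => /eqP mx0.
    have -> : F = N%:R; last by rewrite subrr !mulr0 oppr0.
    rewrite NE /F /qsum big_seq [RHS]big_seq; apply: eq_bigr => m /leq_maxq.
    by rewrite mx0 leqn0 => /eqP ->.
  have FN : F - N%:R <= N%:R * expo (maxq q).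
    apply: (@le_trans _ _ F); first by rewrite gerBl.
    rewrite NE mulr_suml /F /qsum big_seq [leRHS]big_seq; apply: ler_sum => m mq.
    by rewrite mul1r /expo ler_eXn2l// leq_maxq.
  have -> : N%:R * p * (- K * expo (maxq q)) = - (p * (K * (N%:R * expo (maxq q)))) by ring.
  by rewrite lerN2; do 2 apply: ler_wpM2l => //.
have loc : (1 - p) * (- K * X) <= - ((1 - p) * (K * (F - N%:R))).
  rewrite mulNr mulrN lerN2; apply: ler_wpM2l; first by rewrite subr_ge0.
  exact: ler_wpM2l.
have Er : expo_rate = K - lam * (a - 1).
  rewrite /expo_rate /K; by field.
by rewrite Er; move: cen loc; lra.
Qed.

Lemma expo_ge_lin m : m%:R * (a - 1) <= expo m.
Proof.
elim: m => [|m IH]; first by rewrite mul0r ler01.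
have e1 : 1 <= expo m by rewrite exprn_ege1// ltW.
rewrite /expo exprS -/(expo m) -natr1.
have : 0 <= (a - 1) * (expo m - 1) by rewrite mulr_ge0// subr_ge0// ltW.
lra.
Qed.

Lemma qsum_expo_ge q : (sumn q)%:R * (a - 1) <= qsum expo q.
Proof.
rewrite /qsum; elim: q => [|m q IH]; first by rewrite big_nil mul0r.
by rewrite big_cons /= natrD mulrDl lerD// expo_ge_lin.
Qed.

(** This value makes [N] arrivals together weigh half as much as one departure in the drift of
    [reach]. *)
Let eta : R := (2 * N%:R)^-1.

Definition reach q : R := 1 - eta ^+ sumn q.

Lemma NR_ge1 : 1 <= N%:R :> R. Proof. by rewrite ler1n. Qed.

Lemma eta_gt0 : 0 < eta.
Proof. by rewrite invr_gt0 mulr_gt0// ltr0n. Qed.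

Lemma eta_le : eta <= 2^-1.
Proof. by rewrite lef_pV2 ?posrE ?mulr_gt0 ?ltr0n// ler_peMr ?NR_ge1. Qed.

Lemma reach_ge0 q : 0 <= reach q.
Proof.
rewrite subr_ge0 exprn_ile1// ?ltW ?eta_gt0//.
by apply: le_lt_trans eta_le _; rewrite invf_lt1 ?ltr1n.
Qed.

(** Let [d] be the decrease caused by one departure. A nonempty state loses at least [d] through
    services and gains at most [d / 2] from arrivals; since [eta <= 1 / 2], the surplus [d / 2]
    dominates the stated bound. *)
Lemma gen_reach q : validV N q -> (0 < sumn q)%N ->
  gen (trV lam p N) reach q <= - (4^-1 * eta ^+ sumn q).
Proof.
move=> vq; have [sq _] := vq; case T : (sumn q) => [//|t] _.
have e0 := eta_gt0; have e2 := eta_le.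
have up n : (n < N)%N -> reach (incr_nth q n) - reach q <= eta ^+ t.+1 * (1 - eta).
  by move=> nN; rewrite /reach sumn_incr_nth ?sq// T !exprS; lra.
have down n : (n < N)%N -> (0 < nth 0 q n)%N -> reach (decr q n) - reach q <=
    - (eta ^+ t * (1 - eta)).
  by move=> nN n0; rewrite /reach sumn_decr ?sq// T /= !exprS; lra.
have sym (s s' : seq nat) : perm_eq s s' -> reach s = reach s'.
  by move=> ss'; rewrite /reach (perm_sumn ss').
have := @gen_trV_le R lam p N lam_ge0 p_ge0 p_le1 N_gt0 reach
  (fun=> eta ^+ t.+1 * (1 - eta)) (fun=> - (eta ^+ t * (1 - eta))) q vq sym up down.
have mx0 : (0 < maxq q)%N.
  rewrite lt0n; apply: contra_eq_neq T => mx0.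
  suff -> : sumn q = 0%N by [].
  apply/eqP/natnseq0P/all_pred1P/allP => m /leq_maxq; by rewrite mx0 leqn0.
set d := eta ^+ t * (1 - eta); have d0 : 0 < d by rewrite mulr_gt0 ?exprn_gt0//; lra.
have NE : qsum (fun=> eta ^+ t.+1 * (1 - eta)) q = 2^-1 * d.
  rewrite /qsum big_const_seq iter_addr_0 count_predT sq -mulr_natl exprS /d /eta.
  by field; rewrite pnatr_eq0 -lt0n.
have loc : \sum_(m <- q | (0 < m)%N) - d <= - d.
  have mq : maxq q \in q by apply: maxq_mem; rewrite sq.
  rewrite big_mkcond (big_rem _ mq) /= mx0 gerDl; apply: sumr_le0 => m _.
  by case: ifP => _ //; lra.
rewrite mx0 NE => /le_trans; apply.
have h1 : (1 - p) * (\sum_(m <- q | (0 < m)%N) - d) <= (1 - p) * - d.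
  by apply: ler_wpM2l => //; rewrite subr_ge0.
have h2 : p * d <= N%:R * p * d.
  by rewrite -mulrA ler_peMl ?NR_ge1// mulr_ge0// ltW.
have h3 : lam * (2^-1 * d) <= 2^-1 * d.
  by rewrite ler_piMl ?ltW// mulr_gt0.
have h4 : 4^-1 * eta ^+ t.+1 <= 2^-1 * d.
  rewrite exprS /d; have tt : 0 < eta ^+ t by rewrite exprn_gt0.
  have : eta * eta ^+ t <= 2^-1 * eta ^+ t by rewrite ler_pM2r.
  lra.
have : (1 - p) * - d + N%:R * p * - d <= - d.
  by rewrite mulrN; lra.
lra.
Qed.

(* [reach] has negative drift at every nonempty state, but only of order
   [eta ^ T]; it is enough on the finite set where [expo] does not decrease. *)
Lemma foster_function : exists H : seq nat -> R, (forall q, 0 <= H q) /\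
  (forall q, validV N q -> q != nseq N 0%N -> gen (trV lam p N) H q <= -1).
Proof.
pose c := (1 - a^-1) * N%:R + 1.
have c0 : 0 <= c.
  by rewrite addr_ge0// mulr_ge0// subr_ge0 invf_le1 ?a_gt0// ltW.
have d0 : 0 < expo_rate * (a - 1) by rewrite mulr_gt0 ?expo_rate_gt0// subr_gt0.
(* Once the total length reaches [B], the linear lower bound on the exponential sum gives
   [expo_rate * F >= c], so this part alone has drift at most -1. *)
pose B := (Num.truncn (c / (expo_rate * (a - 1)))).+1.
have cB : c <= expo_rate * (a - 1) * B%:R.
  rewrite mulrC -ler_pdivrMr// ltW// /B.
  by have /andP[] := truncn_itv (divr_ge0 c0 (ltW d0)).
have eB : 0 < eta ^+ B by rewrite exprn_gt0// eta_gt0.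
(* Below total length [B] the [reach] part then has drift at most [- c]. *)
pose D := 4 * c / eta ^+ B.
have D0 : 0 <= D by rewrite divr_ge0 ?mulr_ge0// ltW.
exists (fun q => qsum expo q + D * reach q); split.
  by move=> q; apply: addr_ge0; [exact: qsum_ge0 expo_ge0|exact: mulr_ge0 (reach_ge0 q)].
move=> q vq qz.
have -> : gen (trV lam p N) (fun q => qsum expo q + D * reach q) q =
    gen (trV lam p N) (qsum expo) q + D * gen (trV lam p N) reach q.
  by rewrite /gen mulr_sumr -big_split /=; apply: eq_bigr => e _; ring.
have T0 : (0 < sumn q)%N.
  have [y hy _] := trV_descends lam_ge0 p_ge0 p_le1 N_gt0 vq qz.
  exact: leq_ltn_trans hy.
have h1 := gen_expo vq; have h2 := gen_reach vq T0.
have h3 : D * gen (trV lam p N) reach q <= - (4^-1 * (D * eta ^+ sumn q)).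
  have -> : - (4^-1 * (D * eta ^+ sumn q)) = D * (- (4^-1 * eta ^+ sumn q)) by ring.
  exact: ler_wpM2l.
have F0 : 0 <= expo_rate * qsum expo q.
  by apply: mulr_ge0; [exact/ltW/expo_rate_gt0|exact: qsum_ge0 expo_ge0].
have e0 : 0 <= D * eta ^+ sumn q by rewrite mulr_ge0// exprn_ge0// ltW// eta_gt0.
have [BT|TB] := leqP B (sumn q).
  have : c <= expo_rate * qsum expo q.
    apply: le_trans cB _; rewrite -mulrA; apply: ler_wpM2l; first exact/ltW/expo_rate_gt0.
    apply: le_trans (qsum_expo_ge q); rewrite mulrC; apply: ler_wpM2r; last by rewrite ler_nat.
    by rewrite subr_ge0 ltW.
  rewrite /c; lra.
have : 4 * c <= D * eta ^+ sumn q.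
  rewrite /D mulrAC ler_pdivlMr//; apply: ler_wpM2l; first exact: mulr_ge0.
  apply: ler_wiXn2l; [exact/ltW/eta_gt0| |exact: ltnW].
  by apply: le_trans eta_le _; rewrite invf_le1 ?ler1n.
rewrite /c; lra.
Qed.

Lemma system_recurrent : pos_rec_chain lam p N /\
  exists! pi : seq nat -> R, stationary (trV lam p N) (validV N) pi.
Proof.
have [H [H0 drift]] := foster_function.
have tr0 := @trV_ge0 R lam p N lam_ge0 p_ge0 p_le1.
have trv := @trV_valid R lam p N.
have qle := @qrate_trV_le R lam p N lam_ge0 p_ge0 p_le1 N_gt0.
have vz : validV N (nseq N 0%N).
  split; first by rewrite size_nseq.
  have : forall n, path leq 0%N (nseq n 0%N) by elim.
  by move=> h; case: (N) => [//|n]; exact: h.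
have hit x : validV N x -> (Ehit (trV lam p N) (nseq N 0%N) x < +oo)%E.
  by move=> vx; apply: le_lt_trans (Ehit_le tr0 trv H0 drift vx) _; rewrite ltry.
split; first split=> //.
  have [qz|qz] := eqVneq (qrate (trV lam p N) (nseq N 0%N)) 0; [by left|right].
  rewrite lte_add_pinfty ?ltry// big_seq; apply: lte_sum_pinfty => e.
  move=> /mapP[d dout ->] /=; rewrite lte_mul_pinfty// ?lee_fin.
    by rewrite divr_ge0 ?qrate_ge0//; exact: out_ge0 tr0 _ _ dout.
  by apply: hit; exact: out_valid trv _ _ vz dout.
have [pi st] := stationary_exists tr0 trv qle H0 drift vz.
exists pi; split=> // pi' st'.
apply: (stationary_unique tr0 qle _ st st').
exact: trV_descends.
Qed.

End Lyapunov.

(** * Cauchy-Schwarz, telescoping tails and points of [Vbar] *)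

Section RealSums.
Variable R : realType.

Lemma sqr_sum_le (I : Type) (r : seq I) (f : I -> R) :
  (\sum_(i <- r) f i) ^+ 2 <= (size r)%:R * \sum_(i <- r) f i ^+ 2.
Proof.
elim: r => [|i r IH]; first by rewrite !big_nil mulr0 expr0n.
rewrite !big_cons /= -natr1; move: IH.
have : 0 <= \sum_(i <- r) f i ^+ 2 by apply: sumr_ge0 => j _; exact: sqr_ge0.
set A := \sum_(i <- r) f i; set B := \sum_(i <- r) f i ^+ 2.
case: (size r) => [|n] B0; first by rewrite mul0r => h; have : A = 0; nra.
have n0 : 0 < n.+1%:R :> R by rewrite ltr0n.
move: n.+1%:R n0 => k k0 h.
suff : 2 * f i * A <= k * f i ^+ 2 + B by nra.
rewrite -(ler_pM2l k0); have : 0 <= (k * f i - A) ^+ 2 by exact: sqr_ge0.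
nra.
Qed.

Section Telescoping.
Variables (s u : nat -> R).
Hypothesis s_ge0 : forall i, 0 <= s i.
Hypothesis u_ge0 : forall i, 0 <= u i.
Hypothesis u_rec : forall i, u i = s i + u i.+1.

Lemma telescope_from i m : \sum_(0 <= n < m) s (i + n)%N = u i - u (i + m)%N.
Proof.
elim: m => [|m IH]; first by rewrite big_nil addn0 subrr.
by rewrite big_nat_recr//= IH addnS (u_rec (i + m)); ring.
Qed.

Lemma antitone_from i j : (i <= j)%N -> u j <= u i.
Proof.
move=> /subnKC <-; rewrite -subr_ge0 -telescope_from.
exact: sumr_ge0.
Qed.

Lemma esum_from i : (\esum_(j in [set j | (i <= j)%N]) (s j)%:E =
  \esum_(n in [set: nat]) (s (i + n)%N)%:E)%E.
Proof.
apply: reindex_esum; split.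
- by move=> n _ /=; rewrite leq_addr.
- by move=> m n _ _ /addnI.
- by move=> j /= ij; exists (j - i)%N => //; rewrite subnKC.
Qed.

Lemma tail_le i : (\esum_(j in [set j | (i <= j)%N]) (s j)%:E <= (u i)%:E)%E.
Proof.
rewrite esum_from; apply: esum_nat_le => // m.
by rewrite lee_fin telescope_from gerBl.
Qed.

Lemma tail_eq i k : (forall j, (k <= j)%N -> u j = 0) ->
  ((u i)%:E = \esum_(j in [set j | (i <= j)%N]) (s j)%:E)%E.
Proof.
move=> uk; apply/eqP; rewrite eq_le tail_le andbT esum_from.
have -> : u i = \sum_(0 <= n < k) s (i + n)%N.
  by rewrite telescope_from (uk (i + k)%N) ?subr0// leq_addl.
rewrite -nneseries_esumT; last by move=> n; rewrite lee_fin.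
rewrite -sumEFin; apply: nneseries_lim_ge => n _ _; by rewrite lee_fin.
Qed.

(** If [u] stayed above [e], the partial sums from 0 would stay below [u 0 - e], although they
    exhaust [u 0]. *)
Lemma tail_cvg0 (e : R) : ((u 0%N)%:E = \esum_(j in [set j | (0 <= j)%N]) (s j)%:E)%E ->
  0 < e -> exists k, forall j, (k <= j)%N -> u j <= e.
Proof.
move=> u0 e0; apply: contrapT => /forallNP h.
have he j : e <= u j.
  rewrite leNgt; apply/negP => uj; apply: (h j) => i /antitone_from ij.
  exact/ltW/(le_lt_trans ij).
have : ((u 0%N)%:E <= (u 0%N - e)%:E)%E.
  rewrite u0 esum_from; apply: esum_nat_le => [//|m].
  by rewrite telescope_from add0n lee_fin lerB.
by rewrite lee_fin; lra.
Qed.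

End Telescoping.

Lemma Vbar_tails (v : nat -> R) : Vbar v ->
  [/\ forall i, 0 <= v i, v 0%N = 1 + v 1%N,
      forall i, 0 <= v i - v i.+1 <= 1 &
      forall e, 0 < e -> exists k, forall j, (k <= j)%N -> v j <= e].
Proof.
move=> [s [[s0 s01 _ _] vs]].
have s_ge0 i : 0 <= s i by case/andP: (s01 i).
have v_ge0 i : 0 <= v i by rewrite -lee_fin vs esum_ge0// => j _; rewrite lee_fin.
have v_rec i : v i = s i + v i.+1.
  apply: EFin_inj; rewrite EFinD !vs !esum_from.
  rewrite esum_nat_recl; last by move=> n; rewrite lee_fin.
  rewrite addn0; congr (_ + _)%E; apply: eq_esum => n _.
  by rewrite addSnnS.
split=> //.
- by rewrite (v_rec 0%N) s0.
- by move=> i; rewrite {1 2}(v_rec i) addrK.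
- by move=> e; exact: (tail_cvg0 s_ge0 v_rec (vs 0%N)).
Qed.

End RealSums.

(** * Occupancy tails as averages over stations *)

Section Occupancy.
Variables (R : realType) (N : nat).
Implicit Type q : seq nat.

Local Notation V q := (@Vmap R N q).

(** Truncated subtraction counts the levels [j] with [i <= j <= m], that is, what a queue of length
    [m] contributes to [N * V_i]; level 0 counts when [i = 0]. *)
Definition excess (i m : nat) : R := (m.+1 - i)%:R.
Definition above (i m : nat) : R := (i <= m)%:R.

Lemma above_01 i m : 0 <= above i m <= 1.
Proof. by rewrite /above; case: (i <= m)%N; rewrite ?lexx ?ler01. Qed.

Lemma excess_rec i m : excess i m = above i m + excess i.+1 m.
Proof.
rewrite /excess /above subSS; have [im|im] := leqP i m.
  by rewrite subSn// -natr1 addrC.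
by rewrite add0r; congr _%:R; lia.
Qed.

Lemma excess_step i m : excess i m.+1 - excess i m = above i m.+1.
Proof.
rewrite /excess /above; have [im|im] := leqP i m.+1.
  by rewrite subSn// -natr1 addrAC subrr add0r.
have -> : (m.+2 - i = 0)%N by lia.
have -> : (m.+1 - i = 0)%N by lia.
by rewrite subrr.
Qed.

Lemma SfracE q i : Sfrac N q i = qsum (above i) q / N%:R.
Proof.
congr (_ / _); rewrite /qsum; elim: q => [|m q IH]; first by rewrite big_nil.
by rewrite big_cons /= natrD IH.
Qed.

(** Exchanging the sums over levels and stations puts [V] in the additive form to which the one-jump
    formulas for [qsum] apply. *)
Lemma VmapE q i : V q i = qsum (excess i) q / N%:R.
Proof.
rewrite /Vmap; under eq_bigr do rewrite SfracE.
rewrite -mulr_suml; congr (_ / _); rewrite /qsum exchange_big /=.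
rewrite big_seq [RHS]big_seq; apply: eq_bigr => m /leq_maxq mM.
rewrite /excess /above; have [im|im] := leqP i m.+1; last first.
  have -> : (m.+1 - i = 0)%N by lia.
  rewrite big_nat_cond big1// => j /andP[/andP[ij _] _].
  by rewrite leqNgt (leq_trans _ ij)// ltnW.
rewrite (big_cat_nat im)//= [X in _ + X]big_nat_cond [X in _ + X]big1 ?addr0; last first.
  by move=> j /andP[/andP[mj _] _]; rewrite leqNgt mj.
rewrite (eq_big_nat _ _ (F2 := fun=> 1)); first by rewrite sumr_const_nat.
by move=> j /andP[_ jm]; rewrite -ltnS jm.
Qed.

Lemma Vmap_perm i q q' : perm_eq q q' -> V q i = V q' i.
Proof. by move=> qq'; rewrite !VmapE (qsum_perm _ qq'). Qed.

Lemma Vmap_rec q i : V q i = Sfrac N q i + V q i.+1.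
Proof.
rewrite !VmapE SfracE -mulrDl; congr (_ / _); rewrite /qsum -big_split /=.
by apply: eq_bigr => m _; rewrite excess_rec.
Qed.

Lemma Sfrac_ge0 q i : 0 <= Sfrac N q i :> R.
Proof. by rewrite divr_ge0. Qed.

Lemma Vmap_ge0 q i : 0 <= V q i.
Proof. by apply: sumr_ge0 => j _; exact: Sfrac_ge0. Qed.

Lemma Vmap_maxq q i : (maxq q < i)%N -> V q i = 0.
Proof. by move=> qi; rewrite /Vmap big_geq. Qed.

Hypothesis N_gt0 : (0 < N)%N.

Lemma Vmap_gt0 q i : size q = N -> (i <= maxq q)%N -> 0 < V q i.
Proof.
move=> sq iq; have mq : maxq q \in q by apply: maxq_mem; rewrite sq.
rewrite Vmap_rec; apply: ltr_pwDl; last exact: Vmap_ge0.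
rewrite divr_gt0 ?ltr0n// -has_count; apply/hasP; by exists (maxq q).
Qed.

Lemma Sfrac_le1 q i : size q = N -> Sfrac N q i <= 1 :> R.
Proof. by move=> sq; rewrite ler_pdivrMr ?ltr0n// mul1r ler_nat -sq count_size. Qed.

Lemma Sfrac0 q : size q = N -> Sfrac N q 0%N = 1 :> R.
Proof.
move=> sq; rewrite /Sfrac (@eq_count _ _ predT)// count_predT sq divff//.
by rewrite pnatr_eq0 -lt0n.
Qed.

Lemma Vbar_Vmap q : size q = N -> Vbar (V q).
Proof.
move=> sq; exists (Sfrac N q); split; last first.
  move=> i; apply: (@tail_eq _ (Sfrac N q) (V q) _ _ _ i (maxq q).+1).
  - exact: Sfrac_ge0.
  - exact: Vmap_ge0.
  - exact: Vmap_rec.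
  - exact: Vmap_maxq.
split.
- exact: Sfrac0.
- by move=> i; rewrite Sfrac_ge0 Sfrac_le1.
- move=> i; rewrite !SfracE ler_pM2r ?invr_gt0 ?ltr0n//; apply: ler_sum => m _.
  by rewrite ler_nat; case: (ltnP i m) => // /ltnW ->.
- apply: (@le_lt_trans _ _ (V q 1%N)%:E); last by rewrite ltry.
  by apply: tail_le; [exact: Sfrac_ge0|exact: Vmap_ge0|exact: Vmap_rec].
Qed.

End Occupancy.

(** Summation by parts through [2 x_i (x_i - x_(i+1)) = x_i^2 - x_(i+1)^2 + (x_i - x_(i+1))^2]. In
    the induction on [K] the leftover multiple of [x_(K+1)^2] has the factor
    [(1 - rho) * (lam * rho - mu)], zero by the choice of [rho]; the base case uses [x 0 = x 1] and
    [lam * rho <= mu]. *)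
Lemma weighted_form_ge (R : realType) (lam mu rho : R) (x : nat -> R) K :
  0 <= lam -> 0 <= mu -> 0 < rho -> rho <= 1 -> lam * rho <= mu ->
  (1 - rho) * (lam * rho - mu) = 0 -> x 0%N = x 1%N ->
  mu / 2 * (\sum_(1 <= i < K.+1) rho ^+ i * (x i - x i.+1) ^+ 2) -
    mu / 2 * rho ^+ K * x K.+1 ^+ 2 + lam / 2 * rho ^+ K.+1 * x K ^+ 2 <=
  \sum_(1 <= i < K.+1)
     rho ^+ i * (x i * (mu * (x i - x i.+1) - lam * (x i.-1 - x i))).
Proof.
move=> lam0 mu0 r0 r1 lr cancel x01; elim: K => [|K IH].
  rewrite !big_geq// x01 expr0 expr1.
  have : 0 <= (mu - lam * rho) * x 1%N ^+ 2 by rewrite mulr_ge0 ?sqr_ge0// subr_ge0.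
  lra.
rewrite !(big_nat_recr K.+1)//=; move: IH.
set A := \sum_(1 <= i < K.+1) _; set B := \sum_(1 <= i < K.+1) _ => IH.
have c2 : rho ^+ K.+2 = rho * (rho * rho ^+ K) by rewrite !exprS.
have c1 : rho ^+ K.+1 = rho * rho ^+ K by rewrite exprS.
move: IH; rewrite c2 c1; set c := rho ^+ K => IH.
have c0 : 0 < c by rewrite exprn_gt0.
set X := x K.+1 in IH *; set Y := x K in IH *; set Z := x K.+2.
rewrite -subr_ge0.
have -> : B + rho * c * (X * (mu * (X - Z) - lam * (Y - X))) -
   (mu / 2 * (A + rho * c * (X - Z) ^+ 2) - mu / 2 * (rho * c) * Z ^+ 2 +
     lam / 2 * (rho * (rho * c)) * X ^+ 2) =
  (B - (mu / 2 * A - mu / 2 * c * X ^+ 2 + lam / 2 * (rho * c) * Y ^+ 2)) +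
  lam / 2 * rho * c * (X - Y) ^+ 2 + c / 2 * X ^+ 2 * ((1 - rho) * (lam * rho - mu)).
  by field.
rewrite cancel mulr0 addr0 addr_ge0 ?subr_ge0// mulr_ge0 ?sqr_ge0//.
by rewrite !mulr_ge0// ltW.
Qed.

(** * Drift of squared deviations from the fluid fixed point *)

Section FluidDrift.
Variables (R : realType) (lam p : R) (v : nat -> R) (N : nat).
Hypothesis lam_ge0 : 0 <= lam.
Hypothesis p_ge0 : 0 <= p.
Hypothesis p_le1 : p <= 1.
Hypothesis N_gt0 : (0 < N)%N.
Hypothesis Vbar_v : Vbar v.
Hypothesis v_eq : forall i : nat, (1 <= i)%N ->
  lam * (v i.-1 - v i) - (1 - p) * (v i - v i.+1) - g_fun lam p v i = 0.
Implicit Type q : seq nat.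

Definition dev q (i : nat) : R := Vmap N q i - v i.

Lemma dev_perm i q q' : perm_eq q q' -> dev q i = dev q' i.
Proof. by move=> qq'; rewrite /dev (Vmap_perm _ _ i qq'). Qed.

Lemma dev01 q : size q = N -> dev q 0%N = dev q 1%N.
Proof.
move=> sq; have [_ v01 _ _] := Vbar_tails Vbar_v.
by rewrite /dev (Vmap_rec _ _ q 0%N) Sfrac0// v01; ring.
Qed.

(** A jump moves [V_i] by at most [1 / N]. Expanding the square gives a first-order term plus at
    most [1 / (2 N^2)], and the total jump rate is at most [N * (lam + 1)]. *)
Lemma gen_sqr_dev i q : validV N q -> (0 < i)%N ->
  gen (trV lam p N) (fun s => 2^-1 * dev s i ^+ 2) q <=
  dev q i * (lam * Sfrac N q i.-1 - (1 - p) * Sfrac N q i - p * above R i (maxq q)) +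
  (lam + 1) / 2 * N%:R^-1.
Proof.
move=> vq; have [sq _] := vq; case: i => // i _; set x := dev q i.+1.
pose k : R := N%:R^-1; have k0 : 0 < k by rewrite invr_gt0 ltr0n.
have Nk : N%:R * k = 1 by rewrite divff// pnatr_eq0 -lt0n.
pose up m : R := x * (above R i m * k) + 2^-1 * k ^+ 2.
pose down m : R := - (x * (above R i.+1 m * k)) + 2^-1 * k ^+ 2.
have sqrD (d : R) : 0 <= d <= 1 ->
    2^-1 * (x + d * k) ^+ 2 - 2^-1 * x ^+ 2 <= x * (d * k) + 2^-1 * k ^+ 2.
  move=> /andP[d0 d1]; have : d ^+ 2 * k ^+ 2 <= 1 * k ^+ 2.
    by apply: ler_wpM2r; [exact: sqr_ge0|exact: exprn_ile1].
  lra.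
have hup n : (n < N)%N ->
    2^-1 * dev (incr_nth q n) i.+1 ^+ 2 - 2^-1 * dev q i.+1 ^+ 2 <= up (nth 0%N q n).
  move=> nN; have -> : dev (incr_nth q n) i.+1 = x + above R i (nth 0%N q n) * k.
    rewrite /x /dev !VmapE// qsum_incr_nth ?sq// excess_step /k mulrDl.
    by rewrite -[above R i.+1 _]/(above R i _); ring.
  exact/sqrD/above_01.
have hdown n : (n < N)%N -> (0 < nth 0 q n)%N ->
    2^-1 * dev (decr q n) i.+1 ^+ 2 - 2^-1 * dev q i.+1 ^+ 2 <= down (nth 0%N q n).
  move=> nN n0; have -> : dev (decr q n) i.+1 = - (- x + above R i.+1 (nth 0%N q n) * k).
    rewrite /x /dev !VmapE// qsum_decr ?sq//.
    move: n0; case: (nth 0%N q n) => // m _ /=.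
    by rewrite -(excess_step R i.+1 m) /k; ring.
  rewrite sqrrN /down; have /andP[d0 d1] := above_01 R i.+1 (nth 0%N q n).
  move: (above R i.+1 (nth 0%N q n)) d0 d1 => d d0 d1.
  have : d ^+ 2 * k ^+ 2 <= 1 * k ^+ 2.
    by apply: ler_wpM2r; [exact: sqr_ge0|exact: exprn_ile1].
  rewrite -/x; lra.
have sym (s s' : seq nat) : perm_eq s s' -> 2^-1 * dev s i.+1 ^+ 2 = 2^-1 * dev s' i.+1 ^+ 2.
  by move=> ss'; rewrite (dev_perm i.+1 ss').
have := @gen_trV_le R lam p N lam_ge0 p_ge0 p_le1 N_gt0
  (fun s => 2^-1 * dev s i.+1 ^+ 2) up down q vq sym hup hdown.
have cst : \sum_(m <- q) 2^-1 * k ^+ 2 = 2^-1 * k.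
  rewrite big_const_seq iter_addr_0 count_predT sq -[_ *+ N]mulr_natl.
  have -> : N%:R * (2^-1 * k ^+ 2) = (N%:R * k) * (2^-1 * k) by ring.
  by rewrite Nk mul1r.
have -> : qsum up q = x * Sfrac N q i + 2^-1 * k.
  by rewrite SfracE /qsum /up big_split /= cst -mulr_sumr -mulr_suml.
(* At an empty station [down] reduces to its positive noise term because the level is at least 1, so
   the sum may be extended to all stations. *)
have loc : \sum_(m <- q | (0 < m)%N) down m <= - (x * Sfrac N q i.+1) + 2^-1 * k.
  apply: (@le_trans _ _ (qsum down q)); last first.
    by rewrite SfracE /qsum /down big_split /= cst sumrN -mulr_sumr -mulr_suml.
  rewrite /qsum big_mkcond; apply: ler_sum => -[|m] _ //=.
  by rewrite /down /above mul0r mulr0 oppr0 add0r mulr_ge0// sqr_ge0.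
have cen : (if (0 < maxq q)%N then N%:R * p * down (maxq q) else 0) <=
    - (p * (x * above R i.+1 (maxq q))) + p * (2^-1 * k).
  case: ifP => [_|/negbT].
    rewrite /down; set t := above _ _ _.
    have -> : N%:R * p * (- (x * (t * k)) + 2^-1 * k ^+ 2) =
       - (p * (x * t)) * (N%:R * k) + (N%:R * k) * (p * (2^-1 * k)) by ring.
    by rewrite Nk mulr1 mul1r.
  rewrite -leqNgt leqn0 => /eqP ->; rewrite /above !mulr0 oppr0 add0r.
  by rewrite !mulr_ge0// ltW.
have loc' : (1 - p) * (\sum_(m <- q | (0 < m)%N) down m) <=
    (1 - p) * (- (x * Sfrac N q i.+1) + 2^-1 * k).
  by apply: ler_wpM2l => //; rewrite subr_ge0.
move=> h; rewrite [i.+1.-1]/= -/k; move: cen loc' h; set g := gen _ _ _.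
by set l := \sum_(m <- q | _) _; set cc := (if _ then _ else _); lra.
Qed.

(** If level [i] is occupied, the central server works at rate [p]: this equals [g_i] when
    [v i > 0], and otherwise [p >= g_i] while [dev q i > 0]. If it is not, [dev q i = - v i <= 0]
    and [g_i >= 0]. *)
Lemma dev_service_ge0 i q : size q = N -> (0 < i)%N ->
  0 <= dev q i * (p * above R i (maxq q) - g_fun lam p v i).
Proof.
move=> sq i0; have [v0 _ _ _] := Vbar_tails Vbar_v.
have p0 := p_ge0; have lv : 0 <= lam * v i.-1 by rewrite mulr_ge0.
rewrite /dev /g_fun /above; have [iq|iq] := leqP i (maxq q).
  have V0 := Vmap_gt0 R N_gt0 sq iq; rewrite mulr1.
  have [vi|vi] := ltP 0 (v i); first by rewrite subrr mulr0.
  have -> : v i = 0 by apply/eqP; rewrite eq_le vi v0.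
  rewrite subr0 mulr_ge0 ?(ltW V0)// subr_ge0.
  by case: ifP => // _; rewrite ge_min lexx orbT.
rewrite Vmap_maxq// mulr0 !sub0r mulrNN mulr_ge0//.
by case: ifP => // _; case: ifP => // _; rewrite le_min lv p0.
Qed.

Lemma gen_dev_le i q : validV N q -> (0 < i)%N ->
  gen (trV lam p N) (fun s => 2^-1 * dev s i ^+ 2) q +
  dev q i * ((1 - p) * (dev q i - dev q i.+1) - lam * (dev q i.-1 - dev q i)) +
  dev q i * (p * above R i (maxq q) - g_fun lam p v i) <= (lam + 1) / 2 * N%:R^-1.
Proof.
move=> vq i0; have := gen_sqr_dev vq i0; have /(congr1 (fun t => dev q i * t)) := v_eq i0.
have -> : Sfrac N q i = Vmap N q i - Vmap N q i.+1 :> R by rewrite (Vmap_rec R N q i) addrK.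
have -> : Sfrac N q i.-1 = Vmap N q i.-1 - Vmap N q i :> R.
  by rewrite (Vmap_rec R N q i.-1) prednK// addrK.
rewrite /dev mulr0; lra.
Qed.

(** Truncating the weighted sum at [K] leaves the boundary term [dev q K.+1 ^+ 2], its weight
    [rho ^+ K] bounded by 1, for the uniform tail bound to absorb. *)
Lemma gen_weighted_dev rho K q : 0 < rho -> rho <= 1 -> lam * rho <= 1 - p ->
  (1 - rho) * (lam * rho - (1 - p)) = 0 -> validV N q ->
  gen (trV lam p N) (fun s => \sum_(1 <= i < K.+1) rho ^+ i * (2^-1 * dev s i ^+ 2)) q +
  (1 - p) / 2 * (\sum_(1 <= i < K.+1) rho ^+ i * (dev q i - dev q i.+1) ^+ 2) <=
  (1 - p) / 2 * dev q K.+1 ^+ 2 + K%:R * ((lam + 1) / 2 * N%:R^-1).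
Proof.
move=> r0 r1 lr cancel vq; have [sq _] := vq; have p1 := p_le1.
have mu0 : 0 <= 1 - p by rewrite subr_ge0.
have := @weighted_form_ge R lam (1 - p) rho (dev q) K lam_ge0 mu0 r0 r1 lr cancel (dev01 sq).
set A := \sum_(1 <= i < K.+1) _; set B := \sum_(1 <= i < K.+1) _ => form.
have genE : gen (trV lam p N)
     (fun s => \sum_(1 <= i < K.+1) rho ^+ i * (2^-1 * dev s i ^+ 2)) q =
   \sum_(1 <= i < K.+1) rho ^+ i * gen (trV lam p N) (fun s => 2^-1 * dev s i ^+ 2) q.
  rewrite /gen; under [RHS]eq_bigr do rewrite mulr_sumr.
  rewrite exchange_big /=; apply: eq_bigr => e _; rewrite -sumrB mulr_sumr.
  by apply: eq_bigr => i _; ring.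
have rK i : rho ^+ i <= 1 by rewrite exprn_ile1// ltW.
have rK0 i : 0 <= rho ^+ i by rewrite exprn_ge0// ltW.
set nu := (lam + 1) / 2 * N%:R^-1.
have nu0 : 0 <= nu by rewrite /nu !mulr_ge0// ?addr_ge0// invr_ge0.
have sum_le : \sum_(1 <= i < K.+1) rho ^+ i * gen (trV lam p N) (fun s => 2^-1 * dev s i ^+ 2) q
    + B <= K%:R * nu.
  rewrite /B -big_split /=.
  have -> : K%:R * nu = \sum_(1 <= i < K.+1) nu.
    by rewrite sumr_const_nat subSS subn0 mulr_natl.
  rewrite big_nat [leRHS]big_nat; apply: ler_sum => i /andP[i1 _].
  have h1 := gen_dev_le vq i1; have h2 := dev_service_ge0 sq i1.
  rewrite -mulrDr; apply: (@le_trans _ _ (rho ^+ i * nu)); last by rewrite ler_piMl.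
  by apply: ler_wpM2l => //; rewrite -/nu in h1; lra.
have h3 : (1 - p) / 2 * rho ^+ K * dev q K.+1 ^+ 2 <= (1 - p) / 2 * dev q K.+1 ^+ 2.
  rewrite -mulrA; apply: ler_wpM2l; first by rewrite divr_ge0.
  by rewrite ler_piMl// sqr_ge0.
have h4 : 0 <= lam / 2 * rho ^+ K.+1 * dev q K ^+ 2.
  by apply: mulr_ge0; [rewrite mulr_ge0// divr_ge0|exact: sqr_ge0].
rewrite genE; lra.
Qed.

End FluidDrift.

Lemma mean_le_div (R : realType) (S : choiceType) (pi f : S -> R) (c d : R) :
  (forall x, 0 <= pi x) -> (forall x, 0 <= f x) -> 0 < c ->
  (mean pi (fun x => c * f x)%R <= d%:E)%E -> (mean pi f <= (d / c)%:E)%E.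
Proof.
move=> pi0 f0 c0; rewrite meanZ ?(ltW c0)// => h.
rewrite mulrC EFinM -[mean pi f]mul1e -[1%E]/(1%R%:E) -(mulVf (lt0r_neq0 c0)) EFinM -muleA.
by apply: lee_wpmul2l => //; rewrite lee_fin invr_ge0 ltW.
Qed.

Lemma nat_ge_real (R : realType) (x : R) : exists k : nat, x <= k%:R.
Proof.
exists (Num.truncn `|x|).+1; apply: le_trans (ler_norm x) _.
by have /andP[_ /ltW] := truncn_itv (normr_ge0 x).
Qed.

(** * Concentration of the stationary laws at the fixed point *)

Section Concentration.
Variables (R : realType) (lam p b : R) (v : nat -> R) (pi : nat -> seq nat -> R).
Hypothesis lam_ge0 : 0 <= lam.
Hypothesis lam_lt1 : lam < 1.
Hypothesis p_ge0 : 0 <= p.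
Hypothesis p_le1 : p <= 1.
Hypothesis b_gt1 : 1 < b.
Hypothesis lam_b : lam * b ^+ 2 < 1.
Hypothesis Vbar_v : Vbar v.
Hypothesis v_eq : forall i : nat, (1 <= i)%N ->
  lam * (v i.-1 - v i) - (1 - p) * (v i - v i.+1) - g_fun lam p v i = 0.
Hypothesis pi_st : forall n, stationary (trV lam p n.+1) (validV n.+1) (pi n).
Implicit Type q : seq nat.

(** A square, so that squaring Bernoulli's inequality for [b] bounds [excess ^+ 2] by a multiple of
    [a ^ m]. *)
Let a := b ^+ 2.

Lemma sqr_b_gt1 : 1 < a. Proof. by rewrite /a exprn_egt1. Qed.

Lemma pi_ge0 n q : 0 <= pi n q. Proof. by have [] := pi_st n. Qed.
Lemma pi_out n q : ~ validV n.+1 q -> pi n q = 0. Proof. by have [_ h _ _] := pi_st n; exact: h. Qed.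
Lemma pi_total n : (\esum_(q in [set: seq nat]) (pi n q)%:E = 1)%E.
Proof. by have [] := pi_st n. Qed.

Lemma le_mean_pi n f g : (forall q, validV n.+1 q -> f q <= g q) ->
  (mean (pi n) f <= mean (pi n) g)%E.
Proof. exact: (le_mean (pi_ge0 n) (@pi_out n)). Qed.

Lemma drift_pi n (G D f : seq nat -> R) : (forall q, 0 <= G q) -> (forall q, 0 <= D q) ->
  (forall q, 0 <= f q) ->
  (forall q, validV n.+1 q -> gen (trV lam p n.+1) G q + D q <= f q) ->
  (mean (pi n) D <= mean (pi n) f)%E.
Proof.
apply: (stationary_drift _ _ (pi_st n)); first exact: trV_ge0.
exact: qrate_trV_le.
Qed.

Lemma mean_expo n :
  (mean (pi n) (qsum (expo a)) <= ((1 - a^-1) * n.+1%:R / expo_rate lam a)%:E)%E.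
Proof.
have a1 := sqr_b_gt1; have a0 := a_gt0 a1.
have F0 q : 0 <= qsum (expo a) q by apply: qsum_ge0 => m; exact: expo_ge0.
have r0 := expo_rate_gt0 a1 lam_b.
have c0 : 0 <= (1 - a^-1) * n.+1%:R by rewrite mulr_ge0// subr_ge0 invf_le1// ltW.
apply: mean_le_div => //; first exact: pi_ge0.
rewrite -(mean_cst (pi_ge0 n) c0 (pi_total n)).
apply: (@drift_pi n (qsum (expo a))) => //.
  by move=> q; rewrite mulr_ge0// ltW.
by move=> q; exact: gen_expo.
Qed.

Definition kappa : R := a / (b - 1) ^+ 2 * (1 - a^-1) / expo_rate lam a.

Lemma sqr_excess_le k m : excess R k m ^+ 2 <= a / (b - 1) ^+ 2 / a ^+ k * expo a m.
Proof.
have a1 := sqr_b_gt1; have a0 := a_gt0 a1.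
have b1 : 0 < (b - 1) ^+ 2 by rewrite exprn_gt0// subr_gt0.
have ak : 0 < a ^+ k by rewrite exprn_gt0.
have -> : a / (b - 1) ^+ 2 / a ^+ k * expo a m = a ^+ m.+1 / a ^+ k / (b - 1) ^+ 2.
  rewrite /expo [a ^+ m.+1]exprS; move: (a ^+ m) (a ^+ k)^-1 ((b - 1) ^+ 2)^-1 => A B C.
  by ring.
rewrite ler_pdivlMr// -exprMn /excess; have [km|km] := leqP k m.+1; last first.
  have -> : (m.+1 - k = 0)%N by lia.
  by rewrite mul0r expr0n /= divr_ge0// exprn_ge0// ltW.
rewrite -[in leRHS](subnK km) exprD mulfK ?gt_eqF//.
rewrite /a -exprM mulnC exprM ler_pXn2r ?nnegrE ?exprn_ge0//.
- exact: expo_ge_lin.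
- by rewrite mulr_ge0// subr_ge0 ltW.
- by rewrite ltW// (lt_trans ltr01).
Qed.

(** By Cauchy-Schwarz over the stations, [V_k^2] is at most the average of [excess ^+ 2]. The bound
    in [mean_expo] is linear in the number of stations, which cancels against that average. *)
Lemma mean_sqr_Vmap n k :
  (mean (pi n) (fun q => Vmap n.+1 q k ^+ 2)%R <= (kappa / a ^+ k)%:E)%E.
Proof.
have a1 := sqr_b_gt1; have a0 := a_gt0 a1.
have N0 : 0 < n.+1%:R :> R by rewrite ltr0n.
pose c := a / (b - 1) ^+ 2 / a ^+ k / n.+1%:R.
have c0 : 0 <= c.
  have ak : 0 <= a ^+ k by exact: exprn_ge0 (ltW a0).
  by rewrite /c !divr_ge0 ?sqr_ge0// ltW.
apply: (@le_trans _ _ (mean (pi n) (fun q => c * qsum (expo a) q)%R)).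
  apply: le_mean_pi => q [sq _]; rewrite VmapE expr_div_n ler_pdivrMr ?exprn_gt0//.
  apply: le_trans (sqr_sum_le _ _) _; rewrite sq.
  have -> : c * qsum (expo a) q * n.+1%:R ^+ 2 =
      n.+1%:R * (n.+1%:R / n.+1%:R * (a / (b - 1) ^+ 2 / a ^+ k * qsum (expo a) q)).
    rewrite /c; move: (a ^+ k)^-1 ((b - 1) ^+ 2)^-1 => B C.
    by ring.
  rewrite divff ?gt_eqF// mul1r; apply: ler_wpM2l => //.
  by rewrite mulr_sumr; apply: ler_sum => m _; exact: sqr_excess_le.
rewrite meanZ//; last 2 first.
- exact: pi_ge0.
- by move=> q; apply: qsum_ge0 => m; exact: expo_ge0.
apply: (@le_trans _ _ (c%:E * ((1 - a^-1) * n.+1%:R / expo_rate lam a)%:E)%E).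
  by apply: lee_wpmul2l; [rewrite lee_fin|exact: mean_expo].
rewrite -EFinM lee_fin le_eqVlt; apply/orP; left; apply/eqP.
have -> : c * ((1 - a^-1) * n.+1%:R / expo_rate lam a) =
  (n.+1%:R / n.+1%:R) * (a / (b - 1) ^+ 2 * (1 - a^-1) / expo_rate lam a / a ^+ k).
  rewrite /c; move: (a ^+ k)^-1 ((b - 1) ^+ 2)^-1 (expo_rate lam a)^-1 => B C E.
  by ring.
by rewrite divff ?gt_eqF// mul1r.
Qed.

Lemma tail_small (e : R) : 0 < e ->
  exists k, forall j, (k <= j)%N -> kappa / a ^+ j + v j ^+ 2 <= e.
Proof.
move=> e0; have a1 := sqr_b_gt1; have a0 := a_gt0 a1; have [v0 _ _ vt] := Vbar_tails Vbar_v.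
have e20 : 0 < Num.min 1 (e / 2) by rewrite lt_min ltr01 divr_gt0.
have [k1 hk1] := vt _ e20.
have [k2 hk2] := nat_ge_real (kappa / (e / 2) / (a - 1)).
exists (maxn k1 k2) => j; rewrite geq_max => /andP[k1j k2j].
have /hk1 := k1j; rewrite le_min => /andP[v1 v2].
have : v j ^+ 2 <= e / 2.
  by apply: le_trans v2; rewrite expr2 ler_piMl.
have : kappa / a ^+ j <= e / 2.
  have aj : 0 < a ^+ j by exact: exprn_gt0.
  rewrite ler_pdivrMr// mulrC -ler_pdivrMr ?divr_gt0//.
  apply: le_trans (expo_ge_lin a1 j); rewrite -ler_pdivrMr ?subr_gt0//.
  by apply: le_trans hk2 _; rewrite ler_nat.
lra.
Qed.

Lemma mean_sqr_dev n k :
  (mean (pi n) (fun q => dev v n.+1 q k ^+ 2)%R <= (2 * (kappa / a ^+ k + v k ^+ 2))%:E)%E.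
Proof.
apply: (@le_trans _ _ (mean (pi n) (fun q => 2 * Vmap n.+1 q k ^+ 2 + 2 * v k ^+ 2)%R)).
  apply: le_mean_pi => q _; rewrite /dev.
  have : 0 <= (Vmap n.+1 q k + v k) ^+ 2 by exact: sqr_ge0.
  nra.
have v20 : 0 <= 2 * v k ^+ 2 by rewrite mulr_ge0// sqr_ge0.
rewrite meanD; [|exact: pi_ge0|by move=> q; rewrite mulr_ge0// sqr_ge0|by []].
rewrite meanZ; [|exact: pi_ge0|by []|by move=> q; exact: sqr_ge0].
rewrite (mean_cst (pi_ge0 n) v20 (pi_total n)) mulrDr.
rewrite [leRHS]EFinD; apply: leeD => //.
by rewrite [leRHS]EFinM; apply: lee_wpmul2l; [rewrite lee_fin|exact: mean_sqr_Vmap].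
Qed.

(** Positivity of the weight needs [p < 1], hence the separate treatment of [p = 1]. The last
    condition holds because either [rho = 1] or [lam * rho = 1 - p]. *)
Lemma weight_exists : p < 1 -> exists rho : R, [/\ 0 < rho, rho <= 1,
  lam * rho <= 1 - p & (1 - rho) * (lam * rho - (1 - p)) = 0].
Proof.
move=> p1; have [lp|lp] := leP lam (1 - p).
  by exists 1; split=> //; rewrite ?mulr1// subrr mul0r.
have l0 : 0 < lam by apply: lt_trans lp; rewrite subr_gt0.
exists ((1 - p) / lam); split.
- by rewrite divr_gt0// subr_gt0.
- by rewrite ler_pdivrMr// mul1r ltW.
- by rewrite mulrC divfK// gt_eqF.
- by rewrite [lam * _]mulrC divfK ?gt_eqF// subrr mulr0.
Qed.

Lemma increments_small_lt1 j (e : R) : p < 1 -> (0 < j)%N -> 0 < e ->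
  exists n0, forall n, (n0 <= n)%N ->
  (mean (pi n) (fun q => (dev v n.+1 q j - dev v n.+1 q j.+1) ^+ 2)%R <= e%:E)%E.
Proof.
move=> p1 j0 e0; have [rho [r0 r1 lr cancel]] := weight_exists p1.
have mu0 : 0 < 1 - p by rewrite subr_gt0.
(* The coefficient of the [j]-th increment in the weighted form. The error budget [w * e] is shared
   equally: the cutoff [K] controls the boundary term, then [n0] controls the noise. *)
pose w := (1 - p) / 2 * rho ^+ j.
have w0 : 0 < w by rewrite /w mulr_gt0 ?divr_gt0 ?exprn_gt0.
have d0 : 0 < w * e / 2 / (1 - p) by apply: divr_gt0 => //; apply: divr_gt0 => //; exact: mulr_gt0.
have [k hk] := tail_small d0; pose K := maxn k j.
have [n0 hn0] := nat_ge_real (K%:R * ((lam + 1) / 2) / (w * e / 2)).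
exists n0 => n n0n.
have -> : e = w * e / w by rewrite mulrAC divff ?mul1r// gt_eqF.
apply: mean_le_div => //; first exact: pi_ge0.
  by move=> q; exact: sqr_ge0.
pose D q := (1 - p) / 2 * (\sum_(1 <= i < K.+1)
   rho ^+ i * (dev v n.+1 q i - dev v n.+1 q i.+1) ^+ 2).
have rK i : 0 <= rho ^+ i by rewrite exprn_ge0// ltW.
have mu2 : 0 <= (1 - p) / 2 by rewrite divr_ge0// ltW.
have term0 q i : 0 <= rho ^+ i * (dev v n.+1 q i - dev v n.+1 q i.+1) ^+ 2.
  by rewrite mulr_ge0 ?sqr_ge0.
have noise0 : 0 <= K%:R * ((lam + 1) / 2 * n.+1%:R^-1).
  by rewrite !mulr_ge0// ?addr_ge0// invr_ge0.
apply: (@le_trans _ _ (mean (pi n) D)).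
  apply: le_mean_pi => q _; rewrite /w /D -[leLHS]mulrA; apply: ler_wpM2l => //.
  have jK : (j < K.+1)%N by rewrite ltnS leq_maxr.
  rewrite (big_cat_nat j0 (ltnW jK))/= (big_ltn jK) addrCA lerDl.
  by apply: addr_ge0; exact: sumr_ge0.
apply: (@le_trans _ _ (mean (pi n) (fun q => (1 - p) / 2 * dev v n.+1 q K.+1 ^+ 2 +
    K%:R * ((lam + 1) / 2 * n.+1%:R^-1))%R)).
  apply: (@drift_pi n (fun s => \sum_(1 <= i < K.+1) rho ^+ i * (2^-1 * dev v n.+1 s i ^+ 2))).
  - by move=> q; apply: sumr_ge0 => i _; rewrite mulr_ge0// mulr_ge0 ?sqr_ge0.
  - by move=> q; rewrite /D mulr_ge0// sumr_ge0.
  - by move=> q; rewrite addr_ge0// mulr_ge0// sqr_ge0.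
  - by move=> q vq; apply: gen_weighted_dev.
rewrite meanD; [|exact: pi_ge0|by move=> q; rewrite mulr_ge0// sqr_ge0|by []].
rewrite meanZ; [|exact: pi_ge0|by []|by move=> q; exact: sqr_ge0].
rewrite (mean_cst (pi_ge0 n) noise0 (pi_total n)).
apply: (@le_trans _ _ (((1 - p) / 2)%:E * (2 * (w * e / 2 / (1 - p)))%:E + (w * e / 2)%:E)%E).
  apply: leeD.
    apply: lee_wpmul2l; first by rewrite lee_fin.
    apply: le_trans (mean_sqr_dev n K.+1) _; rewrite lee_fin ler_wpM2l//.
    by apply: hk; rewrite leqW// leq_maxl.
  rewrite lee_fin mulrA ler_pdivrMr ?ltr0n// [leRHS]mulrC -ler_pdivrMr; last first.
    by apply: divr_gt0 => //; exact: mulr_gt0.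
  by apply: le_trans hn0 _; rewrite ler_nat leqW.
rewrite -EFinM -EFinD lee_fin; have mN0 := lt0r_neq0 mu0.
by rewrite le_eqVlt; apply/orP; left; apply/eqP; field.
Qed.

(* With [p = 1] only the first coordinate is controlled directly: [v] vanishes
   beyond [0] and each increment [Sfrac] satisfies [S_j ^ 2 <= S_j <= V_1]. *)
Lemma increments_small_eq1 j (e : R) : p = 1 -> (0 < j)%N -> 0 < e ->
  exists n0, forall n, (n0 <= n)%N ->
  (mean (pi n) (fun q => (dev v n.+1 q j - dev v n.+1 q j.+1) ^+ 2)%R <= e%:E)%E.
Proof.
move=> p1 j0 e0; have [v0 v01 v_diff _] := Vbar_tails Vbar_v; have l1 := lam_lt1.
have g1 : g_fun lam p v 1 = lam.
  have := v_eq (isT : (1 <= 1)%N); rewrite /= v01 p1; lra.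
have v1 : v 1%N = 0.
  (* If [v 1 > 0] then [g_1 = p = 1], contrary to [g_1 = lam < 1]. *)
  apply/eqP; rewrite eq_le v0 andbT leNgt; apply/negP => v1.
  by move: g1; rewrite /g_fun v1 p1 => h; move: l1; rewrite -h ltxx.
have vS i : v i.+1 = 0.
  elim: i => // i IH; apply/eqP; rewrite eq_le v0 andbT.
  by have /andP[+ _] := v_diff i.+1; rewrite IH subr_ge0.
have d0 : 0 < (1 - lam) * e by rewrite mulr_gt0// subr_gt0.
have [n0 hn0] := nat_ge_real ((lam + 1) / 2 / ((1 - lam) * e)).
exists n0 => n n0n.
have lN0 : 1 - lam != 0 by rewrite gt_eqF// subr_gt0.
have -> : e = (1 - lam) * e / (1 - lam) by field.
have noise0 : 0 <= (lam + 1) / 2 * n.+1%:R^-1.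
  by rewrite !mulr_ge0// ?addr_ge0// invr_ge0.
apply: mean_le_div; [exact: pi_ge0|by move=> q; exact: sqr_ge0|by rewrite subr_gt0|].
apply: (@le_trans _ _ (mean (pi n) (fun q => (1 - lam) * Vmap n.+1 q 1%N)%R)).
  apply: le_mean_pi => q [sq _]; apply: ler_wpM2l; first by rewrite subr_ge0 ltW.
  have -> : dev v n.+1 q j - dev v n.+1 q j.+1 = Sfrac n.+1 q j.
    rewrite /dev (Vmap_rec _ _ q j); case: j j0 => // i _; rewrite !vS; ring.
  have S0 := Sfrac_ge0 R n.+1 q j.
  apply: (@le_trans _ _ (Sfrac n.+1 q j)).
    by rewrite expr2 ler_piMl//; exact: Sfrac_le1.
  apply: (@le_trans _ _ (Vmap n.+1 q j)).
    by rewrite (Vmap_rec _ _ q j) lerDl Vmap_ge0.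
  by apply: (antitone_from (Sfrac_ge0 R n.+1 q) (Vmap_rec R n.+1 q)).
apply: (@le_trans _ _ (mean (pi n) (fun=> (lam + 1) / 2 * n.+1%:R^-1)%R)).
  apply: (@drift_pi n (fun s => 2^-1 * dev v n.+1 s 1%N ^+ 2)) => //.
  - by move=> q; rewrite mulr_ge0 ?sqr_ge0.
  - by move=> q; rewrite mulr_ge0 ?Vmap_ge0// subr_ge0 ltW.
  - move=> q vq; have [sq _] := vq.
    (* For [p = 1] and level 1 the transport terms vanish, and the service term is [(1 - lam) * V_1]
       whether or not the system is empty. *)
    have := @gen_dev_le R lam p v n.+1 lam_ge0 p_ge0 p_le1 isT v_eq 1%N q vq isT.
    rewrite [1.-1]/= (dev01 (isT : (0 < n.+1)%N) Vbar_v sq) g1 subrr mulr0 subr0.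
    rewrite p1 subrr mul0r mulr0 addr0 mul1r; apply: le_trans; rewrite lerD2l /dev v1 subr0.
    have [mx|mx] := leqP 1 (maxq q).
      by rewrite /above mx [Vmap _ _ _ * _]mulrC.
    by rewrite (Vmap_maxq _ _ mx) mul0r mulr0.
rewrite (mean_cst (pi_ge0 n) noise0 (pi_total n)) lee_fin ler_pdivrMr ?ltr0n//.
rewrite [leRHS]mulrC -ler_pdivrMr//; apply: le_trans hn0 _.
by rewrite ler_nat leqW.
Qed.

Lemma increments_small j (e : R) : (0 < j)%N -> 0 < e ->
  exists n0, forall n, (n0 <= n)%N ->
  (mean (pi n) (fun q => (dev v n.+1 q j - dev v n.+1 q j.+1) ^+ 2)%R <= e%:E)%E.
Proof.
move=> j0 e0; have [p1|p1] := ltP p 1; first exact: increments_small_lt1.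
by apply: increments_small_eq1 => //; apply/eqP; rewrite eq_le p1 p_le1.
Qed.

(** Built to dominate the squared weighted distance by [k] increments and the tails past [k]. The
    constants come from [(x + y)^2 <= 2 x^2 + 2 y^2], used twice, and from the weights [2^-i], whose
    partial sums are at most 2. *)
Definition gap k n q : R :=
  4 * k%:R * (\sum_(1 <= j < k.+1) (dev v n q j - dev v n q j.+1) ^+ 2) +
  8 * (Vmap n q k.+1 ^+ 2 + v k.+1 ^+ 2).

Lemma gap_ge0 k n q : 0 <= gap k n q.
Proof.
rewrite /gap addr_ge0// mulr_ge0// ?addr_ge0 ?sqr_ge0//.
by apply: sumr_ge0 => i _; exact: sqr_ge0.
Qed.

(** A coordinate up to [k] differs from the one at [k.+1] by a sum of increments, handled by
    Cauchy-Schwarz. Past [k] both [V] and [v] are antitone, hence bounded by their values at [k.+1].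
    Coordinate 0 equals coordinate 1. *)
Lemma sqr_dev_le_gap k n q i : size q = n.+1 -> dev v n.+1 q i ^+ 2 <= 2^-1 * gap k n.+1 q.
Proof.
move=> sq; have [v0 v01 v_diff _] := Vbar_tails Vbar_v.
have v_rec j : v j = (v j - v j.+1) + v j.+1 by rewrite subrK.
have s0 j : 0 <= v j - v j.+1 by case/andP: (v_diff j).
pose B := Vmap n.+1 q k.+1 + v k.+1.
pose x := dev v n.+1 q.
have far j : (k < j)%N -> `|x j| <= B.
  move=> kj; apply: le_trans (ler_normB _ _) _.
  rewrite !ger0_norm ?Vmap_ge0//; apply: lerD.
    exact: (antitone_from (Sfrac_ge0 R n.+1 q) (Vmap_rec R n.+1 q)).
  exact: (antitone_from s0 v_rec).
have close_to d : forall j, (j + d = k.+1)%N ->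
    `|x j| <= \sum_(j <= l < k.+1) `|x l - x l.+1| + B.
  elim: d => [|d IH] j jd.
    by rewrite -jd addn0 big_geq// add0r; apply: far; rewrite -[j]addn0 jd.
  have jk : (j < k.+1)%N by lia.
  rewrite (big_ltn jk) -addrA -{1}[x j](subrK (x j.+1)).
  apply: le_trans (ler_normD _ _) _; rewrite lerD2l; apply: IH; lia.
have A_le j : (0 < j)%N -> `|x j| <= \sum_(1 <= l < k.+1) `|x l - x l.+1| + B.
  move=> j0; have [jk|kj] := leqP j k.
    apply: le_trans (close_to (k.+1 - j)%N j _) _; first by lia.
    rewrite lerD2r (big_cat_nat j0 (leqW jk))/= lerDr.
    exact: sumr_ge0.
  by apply: le_trans (far j kj) _; rewrite lerDr; exact: sumr_ge0.
have all_le : `|x i| <= \sum_(1 <= l < k.+1) `|x l - x l.+1| + B.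
  case: i => [|i]; last exact: A_le.
  by rewrite /x (dev01 (isT : (0 < n.+1)%N) Vbar_v sq); exact: A_le.
rewrite -/(x i) -real_normK ?num_real//.
have := @sqr_sum_le R nat (index_iota 1 k.+1) (fun l => `|x l - x l.+1|).
rewrite size_iota subSS subn0; set A := \sum_(1 <= l < k.+1) _ in all_le *.
under eq_bigr do rewrite real_normK ?num_real//.
move=> AA; apply: (@le_trans _ _ ((A + B) ^+ 2)).
  by rewrite ler_pXn2r ?nnegrE ?normr_ge0//; apply: le_trans all_le.
rewrite /gap -/x; set Y := \sum_(1 <= j < k.+1) _ in AA *.
have : 0 <= (A - B) ^+ 2 by exact: sqr_ge0.
have : 0 <= (Vmap n.+1 q k.+1 - v k.+1) ^+ 2 by exact: sqr_ge0.
rewrite /B; nra.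
Qed.

Lemma wdist2_le_gap k n q : size q = n.+1 ->
  (wdist2 (Vmap n.+1 q) v <= (gap k n.+1 q)%:E)%E.
Proof.
move=> sq; apply: esum_nat_le => [i|m].
  by rewrite mulr_ge0 ?sqr_ge0// invr_ge0 exprn_ge0.
rewrite lee_fin; apply: (@le_trans _ _ (\sum_(0 <= i < m) 2 ^- i * (2^-1 * gap k n.+1 q))).
  apply: ler_sum => i _; apply: ler_wpM2l; first by rewrite invr_ge0 exprn_ge0.
  exact: sqr_dev_le_gap.
rewrite -mulr_suml mulrA; apply: ler_piMl; first exact: gap_ge0.
have -> : \sum_(0 <= i < m) (2 : R) ^- i = 2 - 2 * 2 ^- m.
  elim: m => [|m IH]; first by rewrite big_geq// expr0 invr1; ring.
  rewrite big_nat_recr//= IH exprS invfM; field.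
  by rewrite expf_neq0.
have : 0 <= (2 : R) ^- m by rewrite invr_ge0 exprn_ge0.
lra.
Qed.

Lemma increments_small_upto k (e : R) : 0 < e ->
  exists n0, forall n, (n0 <= n)%N -> forall j, (0 < j <= k)%N ->
  (mean (pi n) (fun q => (dev v n.+1 q j - dev v n.+1 q j.+1) ^+ 2)%R <= e%:E)%E.
Proof.
move=> e0; elim: k => [|k [n1 h1]]; first by exists 0%N => n _ [].
have [n2 h2] := increments_small (ltn0Sn k) e0.
exists (maxn n1 n2) => n; rewrite geq_max => /andP[n1n n2n] j /andP[j0].
rewrite leq_eqVlt => /predU1P[->|jk]; first exact: h2.
by apply: h1 => //; rewrite j0.
Qed.

Lemma mean_gap_small (e : R) : 0 < e -> exists k n0, forall n, (n0 <= n)%N ->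
  (mean (pi n) (gap k n.+1) <= e%:E)%E.
Proof.
move=> e0; have e16 : 0 < e / 2 / 8 by rewrite !divr_gt0.
have [k hk] := tail_small e16.
(* The summand 1 keeps the divisor positive when [k = 0]. *)
have k1 : 0 < 4 * k%:R * k%:R + 1 :> R by rewrite ltr_wpDl// !mulr_ge0.
have d0 : 0 < e / 2 / (4 * k%:R * k%:R + 1) by rewrite !divr_gt0.
have [n0 hn0] := increments_small_upto k d0.
exists k, n0 => n n0n.
pose y j q : R := (dev v n.+1 q j - dev v n.+1 q j.+1) ^+ 2.
have y0 j q : 0 <= y j q by exact: sqr_ge0.
have V0 q : 0 <= Vmap n.+1 q k.+1 ^+ 2 :> R by exact: sqr_ge0.
have v0 : 0 <= v k.+1 ^+ 2 by exact: sqr_ge0.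
have -> : mean (pi n) (gap k n.+1) =
   ((4 * k%:R)%:E * (\sum_(1 <= j < k.+1) mean (pi n) (y j)) +
    8%:E * (mean (pi n) (fun q => Vmap n.+1 q k.+1 ^+ 2)%R + (v k.+1 ^+ 2)%:E))%E.
  rewrite -(mean_cst (pi_ge0 n) v0 (pi_total n)) -(mean_sum (pi_ge0 n))//.
  rewrite -(meanD (pi_ge0 n))// -!(meanZ (pi_ge0 n))// ?mulr_ge0//; last 2 first.
  - by move=> q; rewrite addr_ge0.
  - by move=> q; apply: sumr_ge0.
  rewrite -(meanD (pi_ge0 n))//.
  - by move=> q; rewrite !mulr_ge0// sumr_ge0.
  - by move=> q; rewrite mulr_ge0// addr_ge0.
apply: (@le_trans _ _ ((4 * k%:R)%:E * (k%:R * (e / 2 / (4 * k%:R * k%:R + 1)))%:E +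
    8%:E * (e / 2 / 8)%:E)%E).
  apply: leeD; apply: lee_wpmul2l; rewrite ?lee_fin ?mulr_ge0//.
    have -> : k%:R * (e / 2 / (4 * k%:R * k%:R + 1)) =
        \sum_(1 <= j < k.+1) (e / 2 / (4 * k%:R * k%:R + 1)).
      by rewrite sumr_const_nat subSS subn0 mulr_natl.
    rewrite -sumEFin big_nat [leRHS]big_nat; apply: lee_sum => j jk.
    exact: hn0.
  apply: (@le_trans _ _ (kappa / a ^+ k.+1 + v k.+1 ^+ 2)%:E).
    by rewrite EFinD leeD2r// mean_sqr_Vmap.
  by rewrite lee_fin hk.
rewrite -!EFinM -EFinD lee_fin.
have -> : 4 * k%:R * (k%:R * (e / 2 / (4 * k%:R * k%:R + 1))) =
   (4 * k%:R * k%:R) * (e / 2 / (4 * k%:R * k%:R + 1)) by ring.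
have : (4 * k%:R * k%:R + 1) * (e / 2 / (4 * k%:R * k%:R + 1)) = e / 2.
  by rewrite mulrC divfK// gt_eqF.
move: (e / 2 / (4 * k%:R * k%:R + 1)) d0 => t t0; lra.
Qed.

(** Additivity of [mean] is available for nonnegative functions only, so a signed constant is
    written as a difference of the nonnegative [c] and [c']. *)
Lemma mean_shift n (A B r : seq nat -> R) (c c' e : R) :
  (forall q, 0 <= A q) -> (forall q, 0 <= B q) -> (forall q, 0 <= r q) ->
  0 <= c -> 0 <= c' ->
  mean (pi n) A \is a fin_num -> mean (pi n) B \is a fin_num ->
  (mean (pi n) r <= e%:E)%E ->
  (forall q, validV n.+1 q -> A q + c <= B q + c' + r q) ->
  fine (mean (pi n) A) + c <= fine (mean (pi n) B) + c' + e.
Proof.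
move=> A0 B0 r0 c0 c'0 Af Bf re le.
rewrite -lee_fin !EFinD !fineK//.
have := le_mean_pi le; rewrite !(meanD (pi_ge0 n))//; last by move=> q; rewrite addr_ge0.
rewrite !(mean_cst (pi_ge0 n) _ (pi_total n))// => /le_trans; apply.
by rewrite leeD2l.
Qed.

(** Pointwise, [|f(V) - f(v)| <= eps / 2 + M * gap]: continuity covers small [gap], boundedness the
    rest, as in Markov's inequality. Integrating the positive and negative parts of [f] gives both
    one-sided bounds. *)
Lemma dexpect_cvg (f : (nat -> R) -> R) :
  bounded_on_Vbar f -> wcontinuous_on_Vbar f ->
  (fun n : nat => dexpect (pi n) (fun q => f (Vmap n.+1 q))) @ \oo --> (f v)%:E.
Proof.
move=> [C fC] fcont; have fv := fC _ Vbar_v.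
have C0 : 0 <= C by exact: le_trans (normr_ge0 _) fv.
pose pos n q := Num.max (f (Vmap n.+1 q)) 0.
pose neg n q := Num.max (- f (Vmap n.+1 q)) 0.
have pos0 n q : 0 <= pos n q by rewrite le_max lexx orbT.
have neg0 n q : 0 <= neg n q by rewrite le_max lexx orbT.
have hC n q : validV n.+1 q -> `|f (Vmap n.+1 q)| <= C.
  by move=> [sq _]; apply: fC; exact: Vbar_Vmap.
have fin n g : (forall q, 0 <= g q) -> (forall q, validV n.+1 q -> g q <= C) ->
    mean (pi n) g \is a fin_num.
  move=> g0 gC; rewrite ge0_fin_numE; last exact: (mean_ge0 (pi_ge0 n)).
  apply: (@le_lt_trans _ _ (mean (pi n) (fun=> C))); first exact: le_mean_pi.
  by rewrite (mean_cst (pi_ge0 n) C0 (pi_total n)) ltry.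
have posf n : mean (pi n) (pos n) \is a fin_num.
  by apply: fin => // q /hC h; rewrite ge_max C0 andbT (le_trans (ler_norm _)).
have negf n : mean (pi n) (neg n) \is a fin_num.
  by apply: fin => // q /hC h; rewrite ge_max C0 andbT (le_trans (ler_norm _))// normrN.
apply/fine_cvgP; split.
  by apply: nearW => n; rewrite /dexpect fin_numB posf negf.
apply/cvgrPdist_le => eps eps0.
have [d [d0 hd]] := fcont _ Vbar_v (eps / 2) (divr_gt0 eps0 (ltr0n R 2)).
have d20 : 0 < d ^+ 2 by rewrite exprn_gt0.
(* Where [gap >= d ^+ 2], the term [M * gap] is at least [2 * C], which bounds the variation of
   [f]. *)
pose M := 2 * C / d ^+ 2; have M0 : 0 <= M by rewrite divr_ge0 ?mulr_ge0// ltW.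
have M1 : 0 < M + 1 by rewrite ltr_wpDl.
have e0 : 0 < eps / 2 / (M + 1) by rewrite !divr_gt0.
have [k [n0 hn0]] := mean_gap_small e0.
exists n0 => // n n0n /=.
pose r q : R := eps / 2 + M * gap k n.+1 q.
have e20 : 0 <= eps / 2 by rewrite divr_ge0// ltW.
have r0 q : 0 <= r q by apply: addr_ge0 => //; apply: mulr_ge0 => //; exact: gap_ge0.
have re : (mean (pi n) r <= eps%:E)%E.
  rewrite (meanD (pi_ge0 n))//; last by move=> q; rewrite mulr_ge0 ?gap_ge0.
  rewrite (mean_cst (pi_ge0 n) e20 (pi_total n)) (meanZ (pi_ge0 n))//; last first.
    by move=> q; exact: gap_ge0.
  apply: (@le_trans _ _ ((eps / 2)%:E + M%:E * (eps / 2 / (M + 1))%:E)%E).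
    by rewrite leeD2l//; apply: lee_wpmul2l; [rewrite lee_fin|exact: hn0].
  rewrite -EFinM -EFinD lee_fin.
  have : (M + 1) * (eps / 2 / (M + 1)) = eps / 2 by rewrite mulrC divfK// gt_eqF.
  move: (eps / 2 / (M + 1)) e0 => t t0; lra.
have close q : validV n.+1 q -> `|f (Vmap n.+1 q) - f v| <= r q.
  move=> vq; have [sq _] := vq; have [gd|gd] := ltP (gap k n.+1 q) (d ^+ 2).
    have h : `|f (Vmap n.+1 q) - f v| < eps / 2.
      apply: hd; first exact: Vbar_Vmap.
      by apply: le_lt_trans (wdist2_le_gap k sq) _; rewrite lte_fin.
    by apply: le_trans (ltW h) _; rewrite lerDl mulr_ge0 ?gap_ge0.
  apply: le_trans (ler_normB _ _) _.
  apply: (@le_trans _ _ (2 * C)); first by have := hC n q vq; lra.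
  apply: ler_wpDl => //; rewrite /M mulrAC ler_pdivlMr//.
  by apply: ler_wpM2l => //; exact: mulr_ge0.
have posneg q : pos n q - neg n q = f (Vmap n.+1 q).
  rewrite /pos /neg; case: (leP (f (Vmap n.+1 q)) 0) => h.
    by rewrite max_l ?oppr_ge0//; ring.
  by rewrite max_r ?oppr_le0 ?ltW// subr0.
have /ler_normlP[fv1 fv2] := fv.
have up : fine (mean (pi n) (pos n)) + (C - f v) <= fine (mean (pi n) (neg n)) + C + eps.
  apply: (@mean_shift n (pos n) (neg n) r) => //; first by rewrite subr_ge0.
  move=> q vq; have /ler_normlP[_] := close q vq; have := posneg q; lra.
have lo : fine (mean (pi n) (neg n)) + (C + f v) <= fine (mean (pi n) (pos n)) + C + eps.
  apply: (@mean_shift n (neg n) (pos n) r) => //; first by lra.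
  move=> q vq; have /ler_normlP[+ _] := close q vq; have := posneg q; lra.
have -> : fine (dexpect (pi n) (fun q => f (Vmap n.+1 q))) =
    fine (mean (pi n) (pos n)) - fine (mean (pi n) (neg n)).
  exact: fineB (posf n) (negf n).
apply/ler_normlP; split; lra.
Qed.

End Concentration.

Theorem theorem5 (R : realType) (lam p : R)
  (hlam : 0 <= lam) (hlam1 : lam < 1) (hp0 : 0 <= p) (hp1 : p <= 1) :
  (forall N : nat, (0 < N)%N ->
     pos_rec_chain lam p N /\
     exists! pi : seq nat -> R, stationary (trV lam p N) (validV N) pi) /\
  (forall pi : nat -> seq nat -> R,
     (forall N : nat, stationary (trV lam p N.+1) (validV N.+1) (pi N)) ->
   forall vI : nat -> R, Vbar vI ->
     (forall i : nat, (1 <= i)%N ->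
        lam * (vI i.-1 - vI i) - (1 - p) * (vI i - vI i.+1) - g_fun lam p vI i = 0) ->
   forall f : (nat -> R) -> R, bounded_on_Vbar f -> wcontinuous_on_Vbar f ->
     (fun N : nat => dexpect (pi N) (fun s => f (Vmap N.+1 s))) @ \oo
       --> (f vI)%:E).
Proof.
(* Writing [lam = 1 - 4 t] gives [b = 1 + t] and [lam * b^2 <= 1 - 2 t < 1]; the base of the
   exponential Lyapunov function is [b^2]. *)
pose b := 1 + (1 - lam) / 4.
have b1 : 1 < b by rewrite /b; lra.
have lb : lam * b ^+ 2 < 1 by rewrite /b; nra.
split=> [N N0|pi st v Vv veq f fb fc].
  by apply: (@system_recurrent R lam p (b ^+ 2)) => //; exact: exprn_egt1.
exact: (@dexpect_cvg R lam p b).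
Qed.
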